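(* For an arbitrary $b$-marginally bounded $q$-state spin system with $n=|V|$ vertices on a graph of maximum degree $\Delta\ge1$: if $\lceil\theta n\rceil$-uniform block factorization of entropy ($\lceil\theta n\rceil$-UBF) holds with constant $C_{\rm UBF}$ and $0<\theta\le\frac{b^{2(\Delta+1)}}{4e\Delta^2}$, then general block factorization of entropy (GBF) holds with constant $$C_{\rm GBF}=C_{\rm UBF}\times O\left((\theta b^2)^{-1}\log(1/b)\,\Delta^3\right),$$ the implied constant in $O(\cdot)$ being absolute.
   Context: Spin system. Let $q\ge2$, $[q]=\{1,\dots,q\}$, and let $G=(V\cup\partial V,E\cup\partial E)$ be a finite graph, where $\partial V$ is a (possibly empty) boundary set, $E$ is the set of edges inside $V$ and $\partial E$ the set of edges between $V$ and $\partial V$; $n=|V|$. Given nonnegative symmetric matrices $A_{xy}\in\mathbb R_+^{q\times q}$ for $\{x,y\}\in E\cup\partial E$, vectors $B_x\in\mathbb R_+^q$ for $x\in V$, and a boundary condition $\xi\in[q]^{\partial V}$, a configuration $\sigma\in[q]^V$ has weight $w(\sigma)=\prod_{\{x,y\}\in E}A_{xy}(\sigma_x,\sigma_y)\prod_{\{x,y\}\in\partial E,\,x\in V,\,y\in\partial V}A_{xy}(\sigma_x,\xi_y)\prod_{x\in V}B_x(\sigma_x)$. Let $\Omega=\{\sigma:w(\sigma)>0\}$ (assumed nonempty); the Gibbs distribution is $\mu(\sigma)\propto w(\sigma)$ on $\Omega$. For $U\subset V$, a pinning on $U$ is a $\tau\in[q]^U$ that extends to an element of $\Omega$; $\mu^\tau=\mu(\cdot\mid\sigma_U=\tau)$,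 with support $\Omega^\tau$, and $\Omega_x^\tau$ is the set of spins possible at $x$ under $\mu^\tau$. Standing assumption: $\mu$ is totally-connected, i.e. for every pinning $\tau$ the set $\Omega^\tau$ is connected under moves between configurations at Hamming distance 1. The system is $b$-marginally bounded ($b>0$) if $\mu^\tau(\sigma_x=a)\ge b$ for all pinnings $\tau$, all $x\in V$, all $a\in\Omega_x^\tau$. Entropy: $\mathrm{Ent}(f)=\mu[f\log(f/\mu[f])]$; for $B\subset V$, $\mu_B$ is the conditional distribution given the spins outside $B$, and $\mu[\mathrm{Ent}_B(f)]=\mu[f\log(f/\mu_B[f])]$. $\ell$-UBF with constant $C_{\rm UBF}$: for all $f:\Omega\to\mathbb R_+$, $\frac\ell n\mathrm{Ent}(f)\le C_{\rm UBF}\cdot\frac{1}{\binom n\ell}\sum_{S\subset V,|S|=\ell}\mu[\mathrm{Ent}_S(f)]$. GBF with constant $C_{\rm GBF}$: for all $f:\Omega\to\mathbb R_+$ and all probability distributions $\alpha$ over subsets of $V$, $\delta(\alpha)\mathrm{Ent}(f)\le C_{\rm GBF}\sum_{B\subset V}\alpha_B\,\mu[\mathrm{Ent}_B(f)]$, where $\delta(\alpha)=\min_{x\in V}\sum_{B:B\ni x}\alpha_B$. *)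

(* Defs.v *)
From HB Require Import structures.
From mathcomp Require Import all_boot all_order all_algebra.
From mathcomp Require Import reals sequences exp.

Set Implicit Arguments.
Unset Strict Implicit.
Unset Printing Implicit Defensive.

Import Order.TTheory GRing.Theory Num.Theory.
Local Open Scope ring_scope.

(* [V] is the set of interior vertices and [dV] the boundary; [q] spins. *)
Record spinSystem (R : realType) (q : nat) (V dV : finType) := SpinSystem {
  adj : rel (V + dV)%type;
  adj_sym : symmetric adj;
  adj_irr : irreflexive adj;
  adj_bdry : forall u v : dV, ~~ adj (inr u) (inr v);
  edgeA : (V + dV)%type -> (V + dV)%type -> 'M[R]_q;
  (* the matrix is attached to the unordered edge {x, y} *)
  edgeA_swap : forall x y, adj x y -> edgeA x y = edgeA y x;
  edgeA_sym : forall x y, adj x y -> (edgeA x y)^T = edgeA x y;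
  edgeA_ge0 : forall x y, adj x y -> forall a c, 0 <= edgeA x y a c;
  fieldB : V -> 'rV[R]_q;
  fieldB_ge0 : forall x a, 0 <= fieldB x 0 a;
  bcond : {ffun dV -> 'I_q} }.

Definition config (q : nat) (V : finType) := {ffun V -> 'I_q}.

Section SpinSystem.
Variables (R : realType) (q : nat) (V dV : finType) (S : spinSystem R q V dV).
Local Notation config := (config q V).
Implicit Types (s t : config) (U B : {set V}) (f : config -> R).

Definition max_degree : nat := (\max_x #|[set y | adj S x y]|)%N.

(* Ordering the ends by [enum_rank] makes each edge inside V occur once; by
   [edgeA_swap] and [edgeA_sym] the choice of order is immaterial. *)
Definition weight s : R :=
  (\prod_(p : V * V | adj S (inl p.1) (inl p.2)
                      && (enum_rank p.1 < enum_rank p.2)%N)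
     edgeA S (inl p.1) (inl p.2) (s p.1) (s p.2))
  * (\prod_(p : V * dV | adj S (inl p.1) (inr p.2))
     edgeA S (inl p.1) (inr p.2) (s p.1) (bcond S p.2))
  * \prod_(x : V) fieldB S x 0 (s x).

Definition Omega : {set config} := [set s | 0 < weight s].

Definition gibbs s : R := weight s / \sum_t weight t.

(* A partial configuration on U is represented by any total configuration t
   extending it: nothing below depends on the values of t outside U. *)
Definition agree U t s : bool := [forall x in U, s x == t x].

Definition pinning U t : bool := [exists s in Omega, agree U t s].

Definition cond_gibbs U t s : R :=
  if agree U t s then gibbs s / \sum_(s' | agree U t s') gibbs s' else 0.

Definition cond_support U t : {set config} := [set s | 0 < cond_gibbs U t s].

Definition cond_spins U t (x : V) : {set 'I_q} :=
  [set s x | s : config in cond_support U t].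

Definition hamming s t : nat := #|[set x | s x != t x]|.

Definition totally_connected : Prop :=
  forall U t, pinning U t ->
  forall s s', s \in cond_support U t -> s' \in cond_support U t ->
  connect [rel s1 s2 | [&& s1 \in cond_support U t, s2 \in cond_support U t
                         & hamming s1 s2 == 1%N]] s s'.

Definition marginally_bounded (b : R) : Prop :=
  0 < b /\
  forall U t, pinning U t ->
  forall (x : V) (a : 'I_q), a \in cond_spins U t x ->
  b <= \sum_(s : config | s x == a) cond_gibbs U t s.

Definition expect f : R := \sum_s gibbs s * f s.

(* [cond_expect B f s] is the expectation of f under the Gibbs measure
   conditioned on the spins of s outside B. *)
Definition cond_expect B f s : R := \sum_t cond_gibbs (~: B) s t * f t.

(* Since 0 * ln _ = 0, the convention 0 log 0 = 0 is built in. *)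
Definition Ent f : R := expect (fun s => f s * ln (f s / expect f)).

(* The averaged block entropy mu[Ent_B(f)]. *)
Definition mean_Ent B f : R :=
  expect (fun s => f s * ln (f s / cond_expect B f s)).

(* Functions on Omega are taken on all configurations; their values outside
   Omega are arbitrary and only ever appear with weight 0. *)
Definition nonneg_on_Omega f : Prop := forall s, s \in Omega -> 0 <= f s.

Definition UBF (l : nat) (C : R) : Prop :=
  forall f, nonneg_on_Omega f ->
  l%:R / #|V|%:R * Ent f <=
  C * ('C(#|V|, l)%:R^-1 * \sum_(B : {set V} | #|B| == l) mean_Ent B f).

(* For a probability distribution the sums are at most 1, so that the starting
   value 1 does not affect the minimum over a nonempty V. *)
Definition delta (alpha : {set V} -> R) : R :=
  \big[Num.min/1]_(x : V) \sum_(B : {set V} | x \in B) alpha B.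

Definition GBF (C : R) : Prop :=
  forall f, nonneg_on_Omega f ->
  forall alpha : {set V} -> R,
  (forall B, 0 <= alpha B) -> \sum_B alpha B = 1 ->
  delta alpha * Ent f <= C * \sum_B alpha B * mean_Ent B f.

End SpinSystem.

(* Main.v *)
Require Import Defs.
From HB Require Import structures.
From mathcomp Require Import all_boot all_order all_algebra.
From mathcomp Require Import reals sequences exp.
From mathcomp Require Import ring lra zify.

Set Implicit Arguments.
Unset Strict Implicit.
Unset Printing Implicit Defensive.

Import Order.TTheory GRing.Theory Num.Theory.
Local Open Scope ring_scope.

(** The proof interpolates between uniform blocks and general blocks through the
    classes of a proper colouring of the interior graph with [Delta + 1]
    colours. For a fixed function [f], let [H B = mu[Ent_B f]].

    Conditioning on the spins off a set commutes with conditioning off another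
    one that is not adjacent to it ([cond_expect_product]), and [x ln (x / y)]
    is jointly convex. Hence [H] is monotone, and adding [X] to a set increases
    [H] the less, the larger the set, as long as [X] is not adjacent to it
    ([mean_Ent_entropy_like]). On an independent set [W], such as a colour
    class, the chain rule for a fixed order of the vertices then gives the
    weighted Shearer inequality
    [delta(alpha) * H W <= \sum_B alpha_B H (B :&: W)]
    ([independent_shearer]). It remains to bound the average of [H] over
    uniform blocks by a constant times the sum of [H] over the colour classes.

    On any set of [m] vertices, conditionally on the rest, the entropy is at
    most [local_const b m], of order [m ln (1 / b) b ^ (- 2 m)], times the sum
    of the entropies on the colour classes ([local_factorization]). This follows
    from a logarithmic Sobolev inequality that depends only on the least
    probability, at least [b ^ m], and from paths in the connected set of
    configurations. A block [S] is the union of its components, which are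
    conditionally independent; adding them by increasing size yields
    ([component_bound])
      [H S <= \sum_j \sum_(x in S :&: V_j) local_const b (size of the component
      of x) * (increment of H at x)],
    where the increments at the vertices of [S :&: V_j] add up to
    [H (S :&: V_j)].

    For a random block this has to be averaged ([indep_block_sum]). Fix a colour
    class [W]. If the component of [x] has [r] vertices outside [W], it has at
    most [1 + (Delta + 1) r] vertices, and those [r] vertices form a connected
    set for the graph in which vertices with a common neighbour in [W] are also
    joined. Its degree is at most [Delta ^ 2], so that there are at most
    [e (e Delta ^ 2) ^ r] candidates ([clusters_count]), and each lies in the
    block with probability at most [(l / n) ^ r <= (2 theta) ^ r], where
    [l = ceil (theta n)]. Since the candidates avoid [W], this event depends on
    the trace of the block on [W] through its size only. The upper bound on
    [theta] makes the resulting series converge geometrically, with sum of order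
    [Delta ln (1 / b) / b ^ 2] ([cluster_series_bound]). Another factor
    [Delta + 1] comes from the number of colours and [1 / theta] from the left
    side of the uniform inequality.

    If [b > 1 / 2] the Gibbs measure is concentrated on one configuration and
    every entropy vanishes. *)

(** * Set functions on a graph *)

Section Submodular.
Variables (R : realType) (V : finType).
Implicit Types (A B C P Q S T X : {set V}).

(** [X] and [Q] are disjoint and no edge joins them. *)
Definition separated (e : rel V) X Q : Prop :=
  forall x y, x \in X -> y \in Q -> (x != y) && ~~ e x y.

(** The elements of [T] that precede [x] in the enumeration of [V], which
    serves as the fixed total order of all the chain rules below. *)
Definition before T (x : V) : {set V} :=
  [set y in T | (enum_rank y < enum_rank x)%N].

(** The increment of [H] when [x] joins its predecessors in [T]: the term of
    index [x] in the chain rule for [H T]. *)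
Definition incr (H : {set V} -> R) T (x : V) : R :=
  H (before T x :|: [set x]) - H (before T x).

Lemma enum_rank_leS (x y : V) :
  (enum_rank y < (enum_rank x).+1)%N = (y == x) || (enum_rank y < enum_rank x)%N.
Proof.
rewrite ltnS leq_eqVlt; congr orb.
by apply/eqP/eqP => [/ord_inj/enum_rank_inj|->].
Qed.

Lemma sum_incr H T : \sum_(x in T) incr H T x = H T - H set0.
Proof.
pose F k := H [set y in T | (enum_rank y < k)%N].
have -> : H T = F #|V|.
  by congr H; apply/setP=> y; rewrite inE ltn_ord andbT.
have -> : H set0 = F 0%N by congr H; apply/setP=> y; rewrite !inE andbF.
rewrite -(telescope_sumr F (leq0n _)) big_mkord.
rewrite (reindex enum_rank) /=; last exact/onW_bij/enum_rank_bij.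
rewrite big_mkcond /=; apply: eq_bigr => x _; case: ifPn => xT.
  rewrite /incr /F; congr (H _ - _); apply/setP=> y; rewrite !inE.
  rewrite enum_rank_leS.
  by case: eqP => [->|_]; rewrite ?xT ?orbF ?orbT //.
rewrite /F; apply/esym/eqP; rewrite subr_eq0; apply/eqP; congr H.
apply/setP=> y; rewrite !inE enum_rank_leS.
by case: eqP => [->|//]; rewrite (negPf xT).
Qed.

End Submodular.

(** The properties of the averaged block entropies [B |-> mu[Ent_B f]] that the
    combinatorial part of the proof relies on: vanishing at the empty set,
    monotonicity, and submodularity in the restricted form where the set [X]
    that is added is disjoint from the larger of the two sets and has no edge
    to it. *)
Record entropy_like (R : realType) (V : finType) (e : rel V)
    (H : {set V} -> R) : Prop := EntropyLike {
  el_0 : H set0 = 0;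
  el_mono : forall A B : {set V}, A \subset B -> H A <= H B;
  el_dim : forall P Q X : {set V}, P \subset Q -> separated e X Q ->
    H (Q :|: X) - H Q <= H (P :|: X) - H P }.

Section Entropy.
Variables (R : realType) (V : finType) (e : rel V) (H : {set V} -> R).
Hypothesis el : entropy_like e H.
Implicit Types (A B C P Q S T X W : {set V}).

(** No edge has both ends in [W]. *)
Definition independent W : Prop := forall x y, x \in W -> y \in W -> ~~ e x y.

Lemma el_ge0 A : 0 <= H A.
Proof. by rewrite -(el_0 el); apply: (el_mono el); rewrite sub0set. Qed.

Lemma incr_ge0 T x : 0 <= incr H T x.
Proof. by rewrite subr_ge0; apply: (el_mono el); rewrite subsetUl. Qed.

Lemma sum_incr_el T : \sum_(x in T) incr H T x = H T.
Proof. by rewrite sum_incr (el_0 el) subr0. Qed.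

(** Inside an independent set, increments decrease as the set grows. *)
Lemma incr_anti W A B x : independent W -> A \subset B -> B \subset W ->
  x \in W -> incr H B x <= incr H A x.
Proof.
move=> indW sAB sBW xW; apply: (el_dim el).
  apply/subsetP=> y; rewrite !inE => /andP[yA ->].
  by rewrite (subsetP sAB).
move=> u v; rewrite !inE => /eqP -> /andP[vB rv].
rewrite (indW x v xW (subsetP sBW v vB)) andbT.
by apply: contraL rv => /eqP ->; rewrite ltnn.
Qed.

(** A weighted Shearer inequality on an independent set: the chain rule writes
    [H (B :&: W)] as a sum of increments, each at least the increment in [W]. *)
Lemma independent_shearer W (alpha : {set V} -> R) d :
  independent W -> (forall B, 0 <= alpha B) ->
  (forall x, d <= \sum_(B : {set V} | x \in B) alpha B) ->
  d * H W <= \sum_B alpha B * H (B :&: W).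
Proof.
move=> indW a0 dle.
apply: (@le_trans _ _ (\sum_B alpha B * \sum_(x in B :&: W) incr H W x)).
  rewrite -(sum_incr_el W) mulr_sumr.
  under [leRHS]eq_bigr do rewrite mulr_sumr big_mkcond /=.
  rewrite exchange_big /= big_mkcond /=; apply: ler_sum => x _.
  case: ifPn => xW; last first.
    by rewrite big1 // => B _; rewrite inE (negPf xW) andbF.
  under [leRHS]eq_bigr do rewrite inE xW andbT.
  by rewrite -big_mkcond /= -mulr_suml ler_wpM2r ?incr_ge0.
apply: ler_sum => B _; apply: ler_wpM2l; first exact: a0.
rewrite -(sum_incr_el (B :&: W)); apply: ler_sum => x.
by rewrite inE => /andP[_ xW]; apply: (incr_anti indW) => //; rewrite subsetIr.
Qed.

End Entropy.

Section Components.
Variables (V : finType) (e : rel V).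
Hypothesis e_sym : symmetric e.
Implicit Types (S C K : {set V}).

(** The edges of the subgraph induced by [S]. *)
Definition inside S : rel V := [rel u v | [&& u \in S, v \in S & e u v]].

(** The vertex set of the connected component of [x] in the subgraph induced
    by [S]; it is [[set x]] when [x] is not in [S]. *)
Definition component S x : {set V} := [set y | connect (inside S) x y].

Lemma inside_sym S : symmetric (inside S).
Proof. by move=> u v; rewrite /inside /= e_sym andbCA. Qed.

Lemma mem_component S x : x \in component S x.
Proof. by rewrite inE connect0. Qed.

(** A set that contains [x] and is closed under the edges inside [S] contains
    the component of [x]. *)
Lemma component_min S K x : x \in K ->
  (forall u v, u \in K -> u \in S -> v \in S -> e u v -> v \in K) ->
  component S x \subset K.
Proof.
move=> xK cK; apply/subsetP=> y; rewrite inE => /connectP[p + ->].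
elim: p x xK => //= z p IH x xK /andP[/and3P[xS zS exz] pz].
by apply: (IH z) => //; apply: cK exz.
Qed.

Lemma component_sub S x : x \in S -> component S x \subset S.
Proof. by move=> xS; apply: component_min. Qed.

Lemma component_separated S x : x \in S ->
  separated e (component S x) (S :\: component S x).
Proof.
move=> xS u v uC; rewrite inE => /andP[vC vS].
apply/andP; split; first by apply: contraNneq vC => <-.
have uS := subsetP (component_sub xS) u uC.
apply: contra vC => euv; move: uC; rewrite !inE => uC.
by apply: connect_trans uC (connect1 _); rewrite /inside /= uS vS.
Qed.

Lemma component_setD S x y : x \in S -> y \in S :\: component S x ->
  component (S :\: component S x) y = component S y.
Proof.
move=> xS yD; apply/eqP; rewrite eqEsubset; apply/andP; split.
  apply: component_min; first exact: mem_component.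
  move=> u v; rewrite !in_setD => uC /andP[_ uS] /andP[_ vS] euv.
  move: uC; rewrite !inE => uC.
  by apply: connect_trans uC (connect1 _); rewrite /inside /= uS vS.
apply: component_min; first exact: mem_component.
move=> u v uC uS vS euv.
have uD : u \in S :\: component S x by apply: (subsetP (component_sub yD)).
have vD : v \in S :\: component S x.
  rewrite inE vS andbT; apply/negP => vC.
  by have := component_separated xS vC uD; rewrite e_sym euv andbF.
move: uC; rewrite !inE => uC; apply: connect_trans uC (connect1 _).
by rewrite /inside /= uD vD euv.
Qed.

End Components.

Section ComponentBound.
Variables (R : realType) (V : finType) (e : rel V) (H : {set V} -> R).
Variables (k : nat) (c : V -> 'I_k) (G : nat -> R).
Hypothesis e_sym : symmetric e.
Hypothesis el : entropy_like e H.
Hypothesis c_proper : forall x y, e x y -> c x != c y.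
Hypothesis G_mono : {homo G : m n / (m <= n)%N >-> m <= n}.
Implicit Types (S C Q : {set V}) (j : 'I_k).

(** The vertices of colour [j] under the colouring [c]. *)
Definition colour_class j : {set V} := [set x | c x == j].

Hypothesis local : forall C Q, separated e C Q ->
  H (Q :|: C) - H Q <=
  G #|C| * \sum_j (H ((Q :|: C) :&: colour_class j) - H (Q :&: colour_class j)).

Lemma colour_class_indep j : independent e (colour_class j).
Proof.
move=> x y; rewrite !inE => /eqP cx /eqP cy.
by apply/negP => /c_proper; rewrite cx cy eqxx.
Qed.

(** The entropy of a block [S] is bounded colour class by colour class, the
    increment at [x] being weighted by the cost of the component of [x]. The
    weights are attached to the increments of a fixed order of the vertices;
    this is possible because the components are added by increasing size. *)
Lemma component_bound S :
  H S <= \sum_j \sum_(x in S :&: colour_class j)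
            G #|component e S x| * incr H (S :&: colour_class j) x.
Proof.
have [n] := ubnP #|S|; elim: n S => // n IH S ltSn.
have [->|[x0 x0S]] := set_0Vmem S.
  rewrite (el_0 el) big1 // => j _; rewrite big1 // => x.
  by rewrite set0I inE.
have [x xS xmax] := @arg_maxnP _ x0 (mem S) (fun x => #|component e S x|) x0S.
set C := component e S x in xmax; set Q := S :\: C.
have sCS : C \subset S by apply: component_sub.
have defS : S = Q :|: C.
  apply/setP=> y; rewrite in_setU in_setD orbC; have := subsetP sCS y.
  by case: (y \in C) => //= ->.
have sepCQ : separated e C Q by apply: component_separated.
have ltQ : (#|Q| < n)%N.
  rewrite -ltnS; apply: leq_ltn_trans ltSn.
  have := cardsID C S; rewrite (setIidPr sCS) => <-.
  by rewrite -[X in (X < _)%N]add0n ltn_add2r card_gt0; apply/set0Pn; exists x;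
     apply: mem_component.
have /(IH _) {}IH := ltQ.
have cmpQ y : y \in Q -> component e Q y = component e S y.
  by move=> yQ; apply: component_setD.
have cmpC y : y \in C -> (#|component e S y| = #|C|)%N.
  move=> yC; congr #|pred_of_set _|; apply/setP=> z; rewrite !inE.
  move: yC; rewrite inE => yC; apply/esym/same_connect => //.
  exact/sym_connect_sym/inside_sym.
rewrite -[H S](subrK (H Q)) {1}defS.
apply: (le_trans (lerD (local sepCQ) IH)).
rewrite mulr_sumr -big_split /=; apply: ler_sum => j _.
rewrite -defS; set W := colour_class j.
have indW : independent e W by apply: colour_class_indep.
rewrite -!(sum_incr_el el).
(* [C] is the costliest component, so replacing the increments over [Q] by the
   smaller increments over [S] shifts entropy onto [C], which is charged most *)
have key : 0 <= \sum_(x in Q :&: W) (G #|C| - G #|component e S x|) *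
                  (incr H (Q :&: W) x - incr H (S :&: W) x).
  apply: sumr_ge0 => y; rewrite inE => /andP[yQ yW].
  have yS : y \in S by move: yQ; rewrite inE => /andP[].
  apply: mulr_ge0; rewrite subr_ge0; first exact/G_mono/xmax.
  apply: (incr_anti el indW) => //; last exact: subsetIr.
  by apply: setSI; apply: subsetDl.
rewrite -subr_ge0; move: key; congr (0 <= _).
have splitS (F : V -> R) : \sum_(y in S :&: W) F y =
    \sum_(y in Q :&: W) F y + \sum_(y in C :&: W) F y.
  rewrite (big_setID C) /= addrC; congr (_ + _); apply: eq_bigl => y.
    by rewrite !inE andbA.
  rewrite !in_setI; have := subsetP sCS y.
  by case: (y \in C) => [->|_] //; rewrite ?andbT ?andbF.
rewrite !splitS.
have -> : \sum_(y in C :&: W) G #|component e S y| * incr H (S :&: W) y =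
          G #|C| * \sum_(y in C :&: W) incr H (S :&: W) y.
  rewrite mulr_sumr; apply: eq_bigr => y; rewrite inE => /andP[yC _].
  by rewrite cmpC.
have -> : \sum_(y in Q :&: W) G #|component e Q y| * incr H (Q :&: W) y =
          \sum_(y in Q :&: W) G #|component e S y| * incr H (Q :&: W) y.
  by apply: eq_bigr => y; rewrite inE => /andP[yQ _]; rewrite cmpQ.
move: (incr H (Q :&: W)) (incr H (S :&: W)) => u v.
under eq_bigr do rewrite mulrBl !mulrBr.
by rewrite !sumrB -!mulr_sumr; ring.
Qed.
End ComponentBound.

(** * Counting connected sets *)

Section Exploration.
Variables (R : realType) (V : finType) (nb : V -> seq V) (D : nat).
Hypothesis nb_le : forall v, (size (nb v) <= D)%N.
Implicit Types (s : seq V) (T Y Z : {set V}).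

(** All outcomes of an exploration: the vertices of the list [s] are examined in
    turn, each being either rejected or accepted into [Y], and accepting [v]
    appends the list [nb v] of its neighbours to the vertices that remain to be
    examined. Every union of connected sets reached from [s] appears as an
    outcome, and the outcomes are easy to count. Branches that run out of
    [fuel] yield nothing. *)
Fixpoint explore (fuel : nat) s Y : seq {set V} :=
  if fuel is k.+1 then
    if s is v :: s' then
      explore k s' Y ++
      (if v \in Y then [::] else explore k (nb v ++ s') (v |: Y))
    else [:: Y]
  else [::].

Lemma explore_sub T k s Y Z :
  Y \subset T -> {subset s <= T} -> (forall v, {subset nb v <= T}) ->
  Z \in explore k s Y -> Z \subset T.
Proof.
move=> sYT sT nbT; elim: k s Y sYT sT => //= k IH [|v s] Y sYT sT.
  by rewrite inE => /eqP ->.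
have vT : v \in T by apply: sT; rewrite mem_head.
have sT' : {subset s <= T} by move=> u us; apply: sT; rewrite inE us orbT.
rewrite mem_cat => /orP[|]; first exact: IH.
case: ifP => // _; apply: IH; first by rewrite subUset sub1set vT.
by move=> u; rewrite mem_cat => /orP[/nbT|/sT'].
Qed.

(** The generating function of the sizes of the outcomes; with [a = 1 + 1 / D]
    the hypothesis holds for [z = 1 / (e D)]. *)
Lemma explore_sum (z a : R) k s Y : 0 <= z -> 1 <= a -> 1 + z * a ^+ D <= a ->
  \sum_(Z <- explore k s Y) z ^+ #|Z| <= z ^+ #|Y| * a ^+ size s.
Proof.
move=> z0 a1 za; have a0 : 0 <= a by apply: le_trans a1.
have zY0 (X : {set V}) : 0 <= z ^+ #|X| by apply: exprn_ge0.
elim: k s Y => [|k IH] [|v s] Y /=; try by rewrite big_nil mulr_ge0 ?exprn_ge0.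
  by rewrite big_seq1 mulr1.
rewrite big_cat /=; apply: (le_trans (lerD (IH _ _) (lexx _))).
case: ifPn => [_|vY].
  rewrite big_nil addr0; apply: ler_wpM2l => //.
  by rewrite exprS ler_peMl ?exprn_ge0.
apply: (le_trans (lerD (lexx _) (IH _ _))).
rewrite cardsU1 vY add1n exprS size_cat exprD.
have -> : z ^+ #|Y| * a ^+ size s +
    z * z ^+ #|Y| * (a ^+ size (nb v) * a ^+ size s) =
    z ^+ #|Y| * ((1 + z * a ^+ size (nb v)) * a ^+ size s) by ring.
apply: ler_wpM2l => //; rewrite [leRHS]exprS; apply: ler_wpM2r.
  exact: exprn_ge0.
apply: le_trans za; rewrite lerD2l; apply: ler_wpM2l => //.
exact: ler_weXn2l.
Qed.

(** With enough fuel, accepting exactly the vertices of [T] gives an outcome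
    inside [T] that is closed under taking neighbours in [T]. *)
Lemma explore_cover T k s Y :
  (size s + D * #|~: Y| < k)%N -> Y \subset T ->
  (forall u v, u \in Y -> v \in nb u -> v \in T -> (v \in Y) || (v \in s)) ->
  exists2 Z, Z \in explore k s Y &
    [/\ Y \subset Z, Z \subset T, {in s, forall v, v \in T -> v \in Z}
      & forall u v, u \in Z -> v \in nb u -> v \in T -> v \in Z].
Proof.
elim: k s Y => // k IH [|v s] Y /= fuel sYT clY.
  exists Y; rewrite ?inE //; split=> // u v uY vn vT.
  by have := clY u v uY vn vT; rewrite orbF.
have [vT|vT] := boolP (v \in T); last first.
  have [|//|u w uY wn wT|Z ZE [YZ ZT sZ clZ]] := IH s Y.
  - by rewrite -ltnS.
  - have := clY u w uY wn wT; rewrite inE orbCA => /orP[/eqP wv|//].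
    by rewrite -wv wT in vT.
  exists Z; first by rewrite mem_cat ZE.
  split=> // w; rewrite inE => /orP[/eqP -> vT'|]; last exact: sZ.
  by rewrite vT' in vT.
have [vY|vY] := boolP (v \in Y).
  have [|//|u w uY wn wT|Z ZE [YZ ZT sZ clZ]] := IH s Y.
  - by rewrite -ltnS.
  - by have := clY u w uY wn wT; rewrite inE orbCA => /orP[/eqP ->|//]; rewrite vY.
  exists Z; first by rewrite mem_cat ZE.
  split=> // w; rewrite inE => /orP[/eqP -> _|]; last exact: sZ.
  exact: (subsetP YZ).
have [|||Z ZE [YZ ZT sZ clZ]] := IH (nb v ++ s) (v |: Y).
- have cY : (#|~: Y| = #|~: (v |: Y)|.+1)%N.
    by rewrite setCU setIC -setDE [LHS](cardsD1 v) !inE vY.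
  by move: fuel; rewrite cY mulnS size_cat; have := nb_le v; lia.
- by rewrite subUset sub1set vT.
- move=> u w; rewrite in_setU1 => /orP[/eqP ->|uY] wn wT.
    by rewrite mem_cat wn orbT.
  have := clY u w uY wn wT; rewrite in_setU1 mem_cat inE.
  by case: (w \in Y); case: (w == v); case: (w \in nb v).
exists Z; first by rewrite mem_cat ZE orbT.
split=> //; first by apply: subset_trans YZ; apply: subsetUr.
move=> w; rewrite inE => /orP[/eqP -> _|ws wT].
  by apply: (subsetP YZ); rewrite setU11.
by apply: sZ wT; rewrite mem_cat ws orbT.
Qed.

(** At most [e (e D) ^ r] outcomes have size [r]. *)
Lemma explore_count k s r : (0 < D)%N -> (size s <= D)%N ->
  (count (fun Z => #|Z| == r) (explore k s set0))%:R
    <= expR 1 * (expR 1 * D%:R) ^+ r :> R.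
Proof.
move=> D0 sD; have D0' : 0 < D%:R :> R by rewrite ltr0n.
have e0 : 0 < expR 1 :> R by apply: expR_gt0.
pose z : R := (expR 1 * D%:R)^-1; pose a : R := 1 + D%:R^-1.
have aD : a ^+ D <= expR 1.
  have -> : expR 1 = expR D%:R^-1 ^+ D :> R.
    by rewrite -expRM_natl divff ?gt_eqF.
  by apply: lerXn2r; rewrite ?nnegrE ?expR_ge0 ?expR_ge1Dx // addr_ge0 // invr_ge0 ltW.
have z0 : 0 < z by rewrite invr_gt0 mulr_gt0.
have a1 : 1 <= a by rewrite lerDl invr_ge0 ltW.
have za : 1 + z * a ^+ D <= a.
  rewrite lerD2l /z invfM mulrAC; apply: ler_piMl; first by rewrite invr_ge0 ltW.
  by rewrite mulrC ler_pdivrMr // mul1r.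
have H := explore_sum k s set0 (ltW z0) a1 za.
rewrite cards0 expr0 mul1r in H.
rewrite -ler_pdivrMr ?exprn_gt0 ?mulr_gt0 // -exprVn.
apply: le_trans (le_trans H _); last first.
  by apply: le_trans aD; apply: ler_weXn2l.
rewrite -sum1_count natr_sum mulr_suml big_mkcond /=; apply: ler_sum => Z _.
by case: eqP => [->|_]; rewrite ?mul1r // exprn_ge0 // ltW.
Qed.

End Exploration.

(** * Uniformly random sets of a given size *)

Section Averaging.
Variables (R : realType) (V : finType).
Implicit Types (S T W X Y : {set V}).

(** The number of sets of size [l] with prescribed trace of size [t] on [W] and
    containing a given set of size [r] disjoint from [W]. *)
Definition ncompletions W (l r t : nat) : nat :=
  if (t + r <= l)%N then 'C(#|V| - #|W| - r, l - t - r) else 0%N.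

Lemma card_completions W l T Y : Y \subset ~: W -> T \subset W ->
  #|[set S : {set V} | [&& #|S| == l, Y \subset S & S :&: W == T]]| =
  ncompletions W l #|Y| #|T|.
Proof.
move=> sYW sTW; rewrite /ncompletions.
have dTY : [disjoint T & Y].
  by rewrite disjoint_sym disjoints_subset; apply: subset_trans sYW _; rewrite setCS.
have cTY : #|T :|: Y| = (#|T| + #|Y|)%N.
  by rewrite cardsU disjoint_setI0 // cards0 subn0.
have sub S : Y \subset S -> S :&: W == T -> T :|: Y \subset S.
  by move=> YS /eqP <-; rewrite subUset YS subsetIl.
case: ifPn => [le_l|gt_l]; last first.
  apply/eqP; rewrite cards_eq0 -subset0; apply/subsetP=> S.
  rewrite inE => /and3P[/eqP cS YS ST].
  by rewrite -cS -cTY subset_leq_card ?sub in gt_l.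
have -> : (#|V| - #|W| - #|Y| = #|~: (W :|: Y)|)%N.
  rewrite [in RHS]cardsCs setCK cardsU disjoint_setI0 ?cards0 ?subn0 ?subnDA //.
  by rewrite disjoint_sym disjoints_subset.
rewrite -cards_draws.
have <- : [set T :|: Y :|: A | A in [set A : {set V} | A \subset ~: (W :|: Y)
              & #|A| == (l - #|T| - #|Y|)%N]] =
          [set S : {set V} | [&& #|S| == l, Y \subset S & S :&: W == T]].
  apply/setP=> S; apply/imsetP/idP => [[A]|].
    rewrite !inE => /andP[sA /eqP cA ->].
    have dA : [disjoint A & T :|: Y].
      rewrite disjoints_subset; apply: subset_trans sA _.
      by rewrite setCS setSU.
    apply/and3P; split.
    - by rewrite cardsU setIC disjoint_setI0 // cards0 subn0 cTY cA -subnDA subnKC.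
    - by rewrite -setUA setUCA subsetUl.
    - rewrite !setIUl (setIidPl sTW).
      have -> : Y :&: W = set0 by apply/disjoint_setI0; rewrite disjoints_subset.
      have -> : A :&: W = set0.
        apply/disjoint_setI0; rewrite disjoints_subset; apply: subset_trans sA _.
        by rewrite setCS subsetUl.
      by rewrite !setU0.
  rewrite inE => /and3P[/eqP cS YS ST].
  have sTYS := sub S YS ST.
  exists (S :\: (T :|: Y)); last by rewrite -{1}(setIidPr sTYS) setID.
  rewrite inE; apply/andP; split.
    apply/subsetP=> x; rewrite !inE -(eqP ST) inE.
    by case: (x \in S); case: (x \in Y); case: (x \in W).
  by rewrite cardsD (setIidPr sTYS) cS cTY subnDA.
rewrite card_in_imset // => A B; rewrite !inE => /andP[sA _] /andP[sB _] eqAB.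
have key (C : {set V}) : C \subset ~: (W :|: Y) -> C = (T :|: Y :|: C) :\: (T :|: Y).
  move=> sC; apply/setP=> x; rewrite !inE.
  have := subsetP sC x; have := subsetP sTW x; rewrite !inE.
  case: (x \in C); case: (x \in T); case: (x \in Y); case: (x \in W) => //= h1 h2;
  by [have := h1 isT | have := h2 isT].
by rewrite (key A sA) (key B sB) eqAB.
Qed.

(** Only the size of [Y] matters on the right: a sum over the random block,
    restricted to the event that it contains [Y], of a function of its trace on
    [W] depends on [Y] through [#|Y|] alone. *)
Lemma sum_completions W l Y (F : {set V} -> R) : Y \subset ~: W ->
  \sum_(S : {set V} | (#|S| == l) && (Y \subset S)) F (S :&: W) =
  \sum_(T : {set V} | T \subset W) (ncompletions W l #|Y| #|T|)%:R * F T.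
Proof.
move=> sYW.
rewrite (partition_big (fun S => S :&: W) (fun T => T \subset W)) /=; last first.
  by move=> S _; apply: subsetIr.
apply: eq_bigr => T sTW.
rewrite -(card_completions l sYW sTW) -sum1_card natr_sum mulr_suml.
rewrite [RHS](eq_bigl (fun S : {set V} => [&& #|S| == l, Y \subset S & S :&: W == T])).
  rewrite (eq_bigl (fun S : {set V} => [&& #|S| == l, Y \subset S & S :&: W == T])).
    by apply: eq_bigr => S /and3P[_ _ /eqP ->]; rewrite mul1r.
  by move=> S; rewrite andbA.
by move=> S; rewrite inE.
Qed.

Lemma card_supersets l Y :
  #|[set S : {set V} | (#|S| == l) && (Y \subset S)]| =
  if (#|Y| <= l)%N then 'C(#|V| - #|Y|, l - #|Y|) else 0%N.
Proof.
have := @card_completions set0 l set0 Y.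
rewrite setC0 subsetT sub0set => /(_ isT isT).
rewrite /ncompletions !cards0 add0n !subn0 => <-.
by apply: eq_card => S; rewrite !inE setI0 eqxx andbT.
Qed.

(** A uniformly random set of size [l] contains a given set of size [r] with
    probability at most [(l / n) ^ r]. *)
Lemma supersets_le l r : (0 < #|V|)%N -> (l <= #|V|)%N -> (r <= l)%N ->
  'C(#|V| - r, l - r)%:R <= (l%:R / #|V|%:R) ^+ r * 'C(#|V|, l)%:R :> R.
Proof.
move=> n0 ln; elim: r => [_|r IH rl]; first by rewrite !subn0 expr0 mul1r.
have {}IH := IH (ltnW rl); rewrite exprS -mulrA.
apply: le_trans (ler_wpM2l _ IH); last by rewrite divr_ge0 ?ler0n.
rewrite mulrAC ler_pdivlMr ?ltr0n // -!natrM ler_nat.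
have := mul_bin_diag (#|V| - r) (l - r.+1).
have -> : (#|V| - r).-1 = (#|V| - r.+1)%N by rewrite subnS.
have -> : (l - r.+1).+1 = (l - r)%N by rewrite subnSK.
move=> E.
have nr : (0 < #|V| - r)%N by rewrite subn_gt0; apply: leq_trans rl ln.
rewrite -(leq_pmul2l nr) mulnA E.
rewrite -(mulnCA l) mulnAC -mulnA mulnCA [X in (_ <= X)%N]mulnCA.
rewrite !mulnA leq_mul2r; apply/orP; right.
nia.
Qed.

End Averaging.

(** * Averaging over uniform blocks *)

Section Reach.
Variables (R : realType) (V : finType) (e : rel V) (Delta : nat).
Hypothesis e_sym : symmetric e.
Hypothesis e_deg : forall x, (#|[set y | e x y]| <= Delta)%N.
Hypothesis Delta_gt0 : (0 < Delta)%N.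
Variable W : {set V}.
Hypothesis indW : independent e W.
Implicit Types (S Y Z : {set V}) (x y : V).

Lemma card_neighbours Y :
  (#|\bigcup_(y in Y) [set v | e y v]| <= #|Y| * Delta)%N.
Proof.
rewrite -sum_nat_const.
apply: (big_ind2 (fun (A : {set V}) m => (#|A| <= m)%N)) => [|A m B k Am Bk|z _].
- by rewrite cards0.
- by apply: leq_trans (leq_card_setU _ _) (leq_add Am Bk).
- exact: e_deg.
Qed.

(** The vertices outside [W] that are adjacent to [y] or share with it a
    neighbour in [W]. As [W] is independent, a path never visits it twice in a
    row, so that these links preserve the connectivity of the part outside [W]
    of a connected set. *)
Definition two_step_set y : {set V} :=
  [set v in ~: W | e y v || [exists z in W, e y z && e z v]].

Definition two_step y : seq V := enum (two_step_set y).

Lemma size_two_step y : (size (two_step y) <= Delta ^ 2)%N.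
Proof.
rewrite -cardE.
pose E := [set v | e y v].
have sub : two_step_set y \subset
    (E :\: W) :|: \bigcup_(z in E :&: W) [set v | e z v].
  apply/subsetP=> v; rewrite !inE => /andP[vW /orP[->|]]; first by rewrite vW.
  move=> /existsP[z /and3P[zW eyz ezv]]; apply/orP; right.
  by apply/bigcupP; exists z; rewrite !inE ?eyz.
apply: leq_trans (subset_leq_card sub) _.
apply: leq_trans (leq_card_setU _ _) _.
apply: leq_trans (leq_add (leqnn _) (card_neighbours _)) _.
have := cardsID W E; have := e_deg y; rewrite -/E.
nia.
Qed.

(** The neighbours of a vertex [x] of the independent set [W], from which the
    exploration of the component of [x] starts. *)
Definition start x : seq V := enum [set v | e x v].

Lemma size_start x : (size (start x) <= Delta ^ 2)%N.
Proof.
rewrite -cardE; apply: leq_trans (e_deg x) _.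
by rewrite -[X in (X <= _)%N]expn1 leq_pexp2l.
Qed.

(** The candidates for the part outside [W] of the component of [x] in a random
    block. The fuel bounds the number of vertices that can be examined. *)
Definition clusters x : seq {set V} :=
  explore two_step (Delta ^ 2 + Delta ^ 2 * #|V|).+1 (start x) set0.

Lemma clusters_sub x Y : x \in W -> Y \in clusters x -> Y \subset ~: W.
Proof.
move=> xW; apply: explore_sub; first exact: sub0set.
  move=> v; rewrite mem_enum !inE => exv.
  by apply/negP => vW; have := indW xW vW; rewrite exv.
by move=> y v; rewrite mem_enum inE => /andP[].
Qed.

(** Some candidate [Y] contains the part outside [W] of the component of [x];
    the rest of the component consists of [x] and of neighbours of [Y]. *)
Lemma clusters_cover S x : x \in S :&: W ->
  exists2 Y, Y \in clusters x &
    (Y \subset S) /\ (#|component e S x| <= 1 + Delta.+1 * #|Y|)%N.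
Proof.
rewrite inE => /andP[xS xW].
have [|||Y YE [_ YT sY clY]] :=
  @explore_cover V two_step (Delta ^ 2) size_two_step (S :\: W)
    (Delta ^ 2 + Delta ^ 2 * #|V|).+1 (start x) set0.
- rewrite setC0 cardsT ltnS; apply: leq_add => //; exact: size_start.
- exact: sub0set.
- by move=> u v; rewrite inE.
exists Y => //; split; first by apply: subset_trans YT _; apply: subsetDl.
pose N := \bigcup_(y in Y) [set v | e y v].
have cN : (#|N| <= #|Y| * Delta)%N by apply: card_neighbours.
pose K := [set x] :|: Y :|: N :&: W.
have cK : (#|K| <= 1 + Delta.+1 * #|Y|)%N.
  apply: leq_trans (leq_card_setU _ _) _.
  apply: leq_trans (leq_add (leq_card_setU _ _) (leqnn _)) _.
  rewrite cards1 -addnA leq_add2l mulSn leq_add2l mulnC.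
  by apply: leq_trans cN; rewrite subset_leq_card ?subsetIl.
apply: leq_trans cK; apply/subset_leq_card/component_min; first by rewrite !inE eqxx.
move=> u v uK uS vS euv.
(* a neighbour [v] of [K] in [S] lies in [N] if it is in [W], as [W] is
   independent, and otherwise in [Y], by closure of the exploration *)
have [vW|vW] := boolP (v \in W).
  move: uK; rewrite !inE => /orP[/orP[/eqP ux|uY]|/andP[_ uW]].
  - by have := indW xW vW; rewrite -ux euv.
  - by rewrite vW andbT; apply/orP; right; apply/bigcupP; exists u; rewrite ?inE.
  - by have := indW uW vW; rewrite euv.
have vT : v \in S :\: W by rewrite inE vW.
suff vY : v \in Y by rewrite !inE vY orbT.
move: uK; rewrite !inE => /orP[/orP[/eqP ux|uY]|/andP[/bigcupP[y yY]]].
- by apply: sY => //; rewrite mem_enum inE -ux.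
- by apply: (clY u) => //; rewrite mem_enum !inE vW euv.
rewrite inE => eyu uW; apply: (clY y) => //.
by rewrite mem_enum !inE vW; apply/orP; right; apply/existsP; exists u; rewrite uW eyu.
Qed.

Lemma clusters_count x r :
  (count (fun Z => #|Z| == r) (clusters x))%:R <=
    expR 1 * (expR 1 * (Delta ^ 2)%:R) ^+ r :> R.
Proof.
apply: explore_count; first exact: size_two_step.
  by rewrite expn_gt0 Delta_gt0.
exact: size_start.
Qed.

End Reach.

Section UniformBlocks.
Variables (R : realType) (V : finType) (e : rel V) (H : {set V} -> R).
Variables (Delta k : nat) (c : V -> 'I_k) (G : nat -> R).
Hypothesis e_sym : symmetric e.
Hypothesis e_deg : forall x, (#|[set y | e x y]| <= Delta)%N.
Hypothesis Delta_gt0 : (0 < Delta)%N.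
Hypothesis el : entropy_like e H.
Hypothesis c_proper : forall x y, e x y -> c x != c y.
Hypothesis G_ge0 : forall m, 0 <= G m.
Hypothesis G_mono : {homo G : m n / (m <= n)%N >-> m <= n}.
Hypothesis local : forall C Q : {set V}, separated e C Q ->
  H (Q :|: C) - H Q <=
  G #|C| * \sum_j (H ((Q :|: C) :&: colour_class c j)
                   - H (Q :&: colour_class c j)).
Variable l : nat.
Hypothesis V_gt0 : (0 < #|V|)%N.
Hypothesis l_le : (l <= #|V|)%N.

(** Contribution of the components with [r] vertices outside the colour class:
    their number, their cost, and the probability that they occur. *)
Definition cluster_term (r : nat) : R :=
  expR 1 * (expR 1 * (Delta ^ 2)%:R) ^+ r * G (1 + Delta.+1 * r)
  * (l%:R / #|V|%:R) ^+ r.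

(** The weights of [component_bound] average out. The clusters [Y] live outside
    [W], so that given their size the trace of the random block on [W] has the
    same law for all of them; hence the total weight of the increments in the
    trace is controlled by the increments themselves, which add up to the
    entropy of the trace. *)
Lemma indep_block_sum (W : {set V}) : independent e W ->
  \sum_(S : {set V} | #|S| == l)
    \sum_(x in S :&: W) G #|component e S x| * incr H (S :&: W) x
  <= (\sum_(r < #|V|.+1) cluster_term r) * 'C(#|V|, l)%:R * H W.
Proof.
move=> indW.
pose L x := clusters e Delta W x.
pose g r := G (1 + Delta.+1 * r).
pose I (S : {set V}) x := if x \in S :&: W then incr H (S :&: W) x else 0.
have I0 S x : 0 <= I S x by rewrite /I; case: ifP => // _; apply: incr_ge0 el _ _.
pose M r x := \sum_(T : {set V} | T \subset W)
   (ncompletions W l r #|T|)%:R * (if x \in T then incr H T x else 0).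
have M0 r x : 0 <= M r x.
  apply: sumr_ge0 => T _; apply: mulr_ge0 => //.
  by case: ifP => // _; apply: incr_ge0 el _ _.
apply: (@le_trans _ _ (\sum_(S : {set V} | #|S| == l) \sum_(x in W)
    \sum_(Y <- L x | Y \subset S) g #|Y| * I S x)).
  apply: ler_sum => S _; rewrite [leLHS]big_mkcond [leRHS]big_mkcond /=.
  apply: ler_sum => x _; have [xSW|xSW] := boolP (x \in S :&: W); last first.
    by case: ifP => // _; apply: sumr_ge0 => Y _; apply: mulr_ge0; rewrite ?G_ge0.
  have [Y YL [YS cY]] := clusters_cover e_deg Delta_gt0 indW xSW.
  have xW : x \in W by move: xSW; rewrite inE => /andP[].
  rewrite xW big_mkcond /= (big_rem Y) //= YS /I xSW -[leLHS]addr0.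
  apply: lerD; first by apply: ler_wpM2r; [exact: incr_ge0 el _ _|exact: G_mono].
  apply: sumr_ge0 => Z _; case: ifP => // _.
  by apply: mulr_ge0; [exact: G_ge0|exact: incr_ge0 el _ _].
rewrite exchange_big /=.
have step x : x \in W ->
   \sum_(S : {set V} | #|S| == l) \sum_(Y <- L x | Y \subset S) g #|Y| * I S x
   = \sum_(Y <- L x) g #|Y| * M #|Y| x.
  move=> xW; under eq_bigr do rewrite big_mkcond /=.
  rewrite exchange_big /=; apply: eq_big_seq => Y YL.
  have YW := clusters_sub indW xW YL.
  have <- : \sum_(S : {set V} | (#|S| == l) && (Y \subset S)) I S x = M #|Y| x.
    exact: (sum_completions l (fun T => if x \in T then incr H T x else 0) YW).
  by rewrite mulr_sumr -big_mkcondr.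
rewrite (eq_bigr _ step).
have step2 x : x \in W -> \sum_(Y <- L x) g #|Y| * M #|Y| x <=
    \sum_(r < #|V|.+1 | (r <= #|~: W|)%N)
       expR 1 * (expR 1 * (Delta ^ 2)%:R) ^+ r * g r * M r x.
  move=> xW.
  have -> : \sum_(Y <- L x) g #|Y| * M #|Y| x =
     \sum_(r < #|V|.+1 | (r <= #|~: W|)%N) \sum_(Y <- L x | #|Y| == r) g r * M r x.
    rewrite (exchange_big_dep xpredT) //= ; apply: eq_big_seq => Y YL.
    have YW := subset_leq_card (clusters_sub indW xW YL).
    have ltY : (#|Y| < #|V|.+1)%N by rewrite ltnS max_card.
    rewrite (big_pred1 (Ordinal ltY)) // => r /=.
    rewrite -val_eqE /= eq_sym; case: eqP => [->|_]; by rewrite ?YW ?andbF.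
  apply: ler_sum => r _; rewrite -big_filter big_const_seq iter_addr_0 -[leLHS]mulr_natl.
  rewrite count_predT size_filter -[leRHS]mulrA.
  apply: ler_wpM2r; first by apply: mulr_ge0; rewrite ?G_ge0.
  exact: (clusters_count R e_deg Delta_gt0).
apply: (le_trans (ler_sum _ step2)); rewrite exchange_big /=.
rewrite !mulr_suml [leLHS]big_mkcond /=; apply: ler_sum => r _.
have term0 : 0 <= cluster_term r.
  by rewrite /cluster_term !mulr_ge0 ?exprn_ge0 ?mulr_ge0 ?expR_ge0 ?invr_ge0 ?G_ge0 ?ler0n.
case: ifPn => [rW|_]; last first.
  by rewrite mulr_ge0 ?(el_ge0 el) // mulr_ge0.
rewrite -mulr_sumr /cluster_term -/(g r).
rewrite -[leRHS]mulrA -[leRHS]mulrA; apply: ler_wpM2l.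
  by rewrite !mulr_ge0 ?exprn_ge0 ?mulr_ge0 ?expR_ge0 ?G_ge0 ?ler0n.
have sumM : \sum_(x in W) M r x =
    \sum_(T : {set V} | T \subset W) (ncompletions W l r #|T|)%:R * H T.
  rewrite exchange_big /=; apply: eq_bigr => T TW.
  rewrite -mulr_sumr -(sum_incr_el el); congr (_ * _).
  rewrite -big_mkcondr; apply: eq_bigl => x /=.
  by case xT: (x \in T); rewrite ?andbF ?andbT // (subsetP TW).
rewrite sumM.
have [Y0 Y0W /eqP cY0] : exists2 Y : {set V}, Y \subset ~: W & #|Y| == r.
  have : (0 < #|[set A : {set V} | A \subset ~: W & #|A| == r]|)%N.
    by rewrite cards_draws bin_gt0.
  by case/card_gt0P => Y; rewrite inE => /andP[]; exists Y.
apply: (@le_trans _ _ (\sum_(T : {set V} | T \subset W)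
    (ncompletions W l r #|T|)%:R * H W)).
  by apply: ler_sum => T TW; apply: ler_wpM2l => //; apply: el_mono el _ _ TW.
rewrite -cY0 -(sum_completions l (fun _ => H W) Y0W) sumr_const -[leLHS]mulr_natl [leRHS]mulrA.
apply: ler_wpM2r; first exact: el_ge0 el _.
have := card_supersets l Y0; rewrite cY0.
have -> : #|[set S : {set V} | (#|S| == l) && (Y0 \subset S)]| =
          #|[pred S : {set V} | (#|S| == l) && (Y0 \subset S)]|.
  by apply: eq_card => S; rewrite !inE.
move=> ->; case: ifP => rl; first exact: supersets_le.
by rewrite mulr_ge0 ?exprn_ge0 ?mulr_ge0 ?invr_ge0 ?ler0n.
Qed.

Lemma uniform_block_bound :
  'C(#|V|, l)%:R^-1 * \sum_(S : {set V} | #|S| == l) H S <=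
  (\sum_(r < #|V|.+1) cluster_term r) * \sum_j H (colour_class c j).
Proof.
have Cgt0 : 0 < 'C(#|V|, l)%:R :> R by rewrite ltr0n bin_gt0.
rewrite ler_pdivrMl //.
apply: le_trans (ler_sum _ (fun S _ => component_bound e_sym el c_proper G_mono local S)) _.
rewrite exchange_big /= mulrA mulr_sumr; apply: ler_sum => j _.
rewrite [X in X * H _]mulrC; apply: indep_block_sum.
exact: colour_class_indep.
Qed.

End UniformBlocks.

(** * Conditional expectations under the Gibbs measure *)

Section Conditioning.
Variables (R : realType) (q : nat) (V dV : finType) (S : spinSystem R q V dV).
Hypothesis Omega_neq0 : Omega S != set0.
Local Notation config := (config q V).
Local Notation p := (gibbs S).
Local Notation E := (expect S).
Local Notation mu := (cond_expect S).
Implicit Types (s t u v : config) (A B P Q X : {set V}) (f g h : config -> R).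

(** Adjacency of interior vertices. *)
Definition vertex_adj : rel V := fun x y => adj S (inl x) (inl y).

(** The configurations [s] and [t] agree outside [B]. *)
Definition same_off B s t : bool := agree (~: B) s t.

(** The Gibbs probability of the spins of [s] outside [B]. *)
Definition class_mass B s : R := \sum_(t | same_off B s t) p t.

Lemma same_offP B s t :
  reflect (forall x, x \notin B -> t x = s x) (same_off B s t).
Proof.
apply: (iffP forallP) => st x; last first.
  by apply/implyP; rewrite inE => /st ->.
by move=> xB; have := st x; rewrite inE xB => /eqP.
Qed.

Lemma same_off_refl B s : same_off B s s.
Proof. exact/same_offP. Qed.

Lemma same_off_sym B s t : same_off B s t = same_off B t s.
Proof. by apply/same_offP/same_offP => st x /st. Qed.

Lemma same_off_trans B t s u : same_off B s t -> same_off B t u -> same_off B s u.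
Proof.
by move=> /same_offP st /same_offP tu; apply/same_offP => x xB; rewrite tu ?st.
Qed.

Lemma same_off_sub A B s t : A \subset B -> same_off A s t -> same_off B s t.
Proof.
move=> /subsetP sAB /same_offP st; apply/same_offP => x xB; apply: st.
by apply: contra xB => /sAB.
Qed.

Lemma same_off_eq B s t : same_off B s t -> same_off B s =1 same_off B t.
Proof.
move=> st u; apply/idP/idP; apply: same_off_trans => //.
by rewrite same_off_sym.
Qed.

Lemma class_mass_eq B s t : same_off B s t -> class_mass B s = class_mass B t.
Proof. by move=> st; apply: eq_bigl; apply: same_off_eq. Qed.

Lemma weight_ge0 s : 0 <= weight S s.
Proof.
rewrite /weight !mulr_ge0 //; apply: prodr_ge0.
- by move=> [x y] /= /andP[xy _]; apply: edgeA_ge0.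
- by move=> [x y] /= xy; apply: edgeA_ge0.
- by move=> x _; apply: fieldB_ge0.
Qed.

Lemma weight_sum_gt0 : 0 < \sum_t weight S t.
Proof.
have [s] := set0Pn _ Omega_neq0; rewrite inE => ws.
rewrite (bigD1 s) //= ltr_wpDr //; apply: sumr_ge0 => t _; exact: weight_ge0.
Qed.

Lemma gibbs_ge0 s : 0 <= p s.
Proof. by rewrite divr_ge0 ?weight_ge0 // ltW ?weight_sum_gt0. Qed.

Lemma gibbs_gt0 s : (0 < p s) = (s \in Omega S).
Proof. by rewrite inE pmulr_lgt0 // invr_gt0 weight_sum_gt0. Qed.

Lemma gibbs_sum1 : \sum_s p s = 1.
Proof. by rewrite -mulr_suml divff // gt_eqF ?weight_sum_gt0. Qed.

Lemma class_mass_ge0 B s : 0 <= class_mass B s.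
Proof. by apply: sumr_ge0 => t _; apply: gibbs_ge0. Qed.

Lemma gibbs_le_mass B s t : same_off B s t -> p t <= class_mass B s.
Proof.
move=> st; rewrite /class_mass (bigD1 t) //= lerDl.
by apply: sumr_ge0 => u _; apply: gibbs_ge0.
Qed.

Lemma class_mass_gt0 B s : 0 < p s -> 0 < class_mass B s.
Proof. by move=> ps; apply: (lt_le_trans ps); apply/gibbs_le_mass/same_off_refl. Qed.

Lemma cond_expectE B f s :
  mu B f s = \sum_(t | same_off B s t) p t / class_mass B s * f t.
Proof.
rewrite /cond_expect [RHS]big_mkcond; apply: eq_bigr => t _.
by rewrite /cond_gibbs -/(same_off B s t); case: ifP => //; rewrite mul0r.
Qed.

Lemma cond_expect_eq B f g s :
  (forall t, same_off B s t -> 0 < p t -> f t = g t) -> mu B f s = mu B g s.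
Proof.
move=> fg; rewrite !cond_expectE; apply: eq_bigr => t st.
have := gibbs_ge0 t; rewrite le_eqVlt => /predU1P[<-|pt]; first by rewrite !mul0r.
by rewrite (fg t).
Qed.

Lemma cond_expect_class B f s t : same_off B s t -> mu B f s = mu B f t.
Proof.
move=> st; rewrite !cond_expectE (class_mass_eq st).
by apply: eq_bigl; apply: same_off_eq.
Qed.

Lemma cond_expect_ge0 B f s : (forall t, 0 <= f t) -> 0 <= mu B f s.
Proof.
move=> f0; rewrite cond_expectE; apply: sumr_ge0 => t _.
by rewrite mulr_ge0 // divr_ge0 ?gibbs_ge0 ?class_mass_ge0.
Qed.

Lemma cond_expect_gt0 B f s : (forall t, 0 <= f t) -> 0 < p s -> 0 < f s ->
  0 < mu B f s.
Proof.
move=> f0 ps fs; rewrite cond_expectE (bigD1 s) ?same_off_refl //=.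
rewrite ltr_wpDr //.
  by apply: sumr_ge0 => t _; rewrite mulr_ge0 // divr_ge0 ?gibbs_ge0 ?class_mass_ge0.
by rewrite mulr_gt0 // divr_gt0 // class_mass_gt0.
Qed.

Lemma cond_expect_le B f g s :
  (forall t, same_off B s t -> 0 < p t -> f t <= g t) -> mu B f s <= mu B g s.
Proof.
move=> fg; rewrite !cond_expectE; apply: ler_sum => t st.
have := gibbs_ge0 t; rewrite le_eqVlt => /predU1P[<-|pt]; first by rewrite !mul0r.
by rewrite ler_wpM2l ?fg // divr_ge0 ?gibbs_ge0 ?class_mass_ge0.
Qed.

Lemma cond_expectD B f g s : mu B (fun t => f t + g t) s = mu B f s + mu B g s.
Proof. by rewrite !cond_expectE -big_split; apply: eq_bigr => t _; rewrite mulrDr. Qed.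

Lemma cond_expectN B f s : mu B (fun t => - f t) s = - mu B f s.
Proof. by rewrite !cond_expectE -sumrN; apply: eq_bigr => t _; rewrite mulrN. Qed.

Lemma cond_expectZ B c f s : mu B (fun t => c * f t) s = c * mu B f s.
Proof. by rewrite !cond_expectE mulr_sumr; apply: eq_bigr => t _; rewrite mulrCA. Qed.

Lemma cond_expect_sum B (I : finType) (F : I -> config -> R) s :
  mu B (fun t => \sum_i F i t) s = \sum_i mu B (F i) s.
Proof.
rewrite cond_expectE; under eq_bigr do rewrite mulr_sumr.
by rewrite exchange_big; apply: eq_bigr => i _; rewrite cond_expectE.
Qed.

Lemma cond_expect_cst B c s : 0 < p s -> mu B (fun=> c) s = c.
Proof.
move=> ps; rewrite cond_expectE -mulr_suml -mulr_suml divff ?mul1r //.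
by rewrite gt_eqF ?class_mass_gt0.
Qed.

(** A factor that depends only on the spins outside [B] can be pulled out. *)
Lemma cond_expect_pull B f g s :
  (forall t, same_off B s t -> g t = g s) ->
  mu B (fun t => f t * g t) s = mu B f s * g s.
Proof.
move=> gs; rewrite !cond_expectE mulr_suml; apply: eq_bigr => t st.
by rewrite gs // mulrA.
Qed.

Lemma cond_expect_set0 f s : 0 < p s -> mu set0 f s = f s.
Proof.
move=> ps; rewrite -[RHS](cond_expect_cst set0 _ ps); apply: cond_expect_eq => t st _.
by congr f; apply/ffunP => x; move/same_offP: st; apply; rewrite inE.
Qed.

Lemma expectE f s : E f = mu setT f s.
Proof.
have all t : same_off setT s t by apply/same_offP => x; rewrite inE.
rewrite cond_expectE; apply: eq_big => t; first by rewrite all.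
move=> _; suff -> : class_mass setT s = 1 by rewrite divr1.
by rewrite -gibbs_sum1; apply: eq_bigl => u; rewrite all.
Qed.

Lemma cond_expect_tower P Q f s : P \subset Q -> mu Q (mu P f) s = mu Q f s.
Proof.
move=> sPQ; rewrite !cond_expectE.
under eq_bigr do rewrite cond_expectE mulr_sumr.
rewrite (exchange_big_dep (same_off Q s)) /=; last first.
  by move=> t u st tu; apply: same_off_trans st (same_off_sub sPQ tu).
apply: eq_bigr => u su.
transitivity (\sum_(t | same_off P u t)
    p t / class_mass P u * (p u / class_mass Q s * f u)).
  rewrite (eq_bigl (same_off P u)) => [|t].
    by apply: eq_bigr => t ut; rewrite -(class_mass_eq ut); ring.
  rewrite [X in _ && X]same_off_sym andb_idl // => ut.
  by apply: same_off_trans su (same_off_sub sPQ ut).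
rewrite -mulr_suml -mulr_suml -/(class_mass P u).
have := gibbs_ge0 u; rewrite le_eqVlt => /predU1P[<-|pu].
  by rewrite !mul0r mulr0.
by rewrite divff ?mul1r // gt_eqF ?class_mass_gt0.
Qed.

Lemma expect_cond B f : E (mu B f) = E f.
Proof.
have [s _] := set0Pn _ Omega_neq0.
by rewrite !(expectE _ s) cond_expect_tower ?subsetT.
Qed.

Lemma expect_eq f g : (forall s, 0 < p s -> f s = g s) -> E f = E g.
Proof.
have [s _] := set0Pn _ Omega_neq0.
by move=> fg; rewrite !(expectE _ s); apply: cond_expect_eq => t _; apply: fg.
Qed.

Lemma expect_le f g : (forall s, 0 < p s -> f s <= g s) -> E f <= E g.
Proof.
have [s _] := set0Pn _ Omega_neq0.
by move=> fg; rewrite !(expectE _ s); apply: cond_expect_le => t _; apply: fg.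
Qed.

Lemma expectB f g : E (fun s => f s - g s) = E f - E g.
Proof.
have [s _] := set0Pn _ Omega_neq0.
by rewrite !(expectE _ s) cond_expectD cond_expectN.
Qed.

(** The configuration equal to [t] on [X] and to [s] elsewhere. *)
Definition mix X t s : config := [ffun x => if x \in X then t x else s x].

Lemma vertex_adj_sym : symmetric vertex_adj.
Proof. by move=> x y; apply: adj_sym. Qed.

(** Each factor of the weight involves an edge or a vertex, and so cannot depend
    on the spins in [X] and in [Q] at once: exchanging the spins in [X] between
    two configurations that agree off [X] and [Q] permutes the factors. *)
Lemma weight_exchange X Q s t : separated vertex_adj X Q ->
  same_off (X :|: Q) s t ->
  weight S t * weight S s = weight S (mix X t s) * weight S (mix X s t).
Proof.
move=> sepXQ /same_offP st.
(* a neighbour of [X] outside [X] is outside [Q] as well *)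
have nb x y : x \in X -> y \notin X -> vertex_adj x y -> t y = s y.
  move=> xX yX xy; apply: st; rewrite !inE negb_or yX.
  by apply/negP => yQ; have /andP[_] := sepXQ x y xX yQ; rewrite xy.
rewrite /weight.
have mul3 (a b c a' b' c' : R) :
    a * b * c * (a' * b' * c') = (a * a') * (b * b') * (c * c') by ring.
rewrite !mul3 -!big_split /=; congr (_ * _ * _).
- apply: eq_bigr => -[x y] /= /andP[xy _]; rewrite !ffunE.
  have yx : vertex_adj y x by rewrite vertex_adj_sym.
  have := nb x y; have := nb y x.
  case: (x \in X); case: (y \in X) => //= nyx nxy.
  + by rewrite (nxy isT isT).
  + by rewrite (nyx isT isT).
  + by rewrite mulrC.
- apply: eq_bigr => -[x y] /= xy; rewrite !ffunE.
  by case: (x \in X) => //; rewrite mulrC.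
- apply: eq_bigr => x _; rewrite !ffunE.
  by case: (x \in X) => //; rewrite mulrC.
Qed.

Lemma gibbs_exchange X Q s t : separated vertex_adj X Q ->
  same_off (X :|: Q) s t -> p t * p s = p (mix X t s) * p (mix X s t).
Proof.
move=> sepXQ st; rewrite /gibbs mulf_div mulf_div.
by rewrite (weight_exchange sepXQ st).
Qed.

Lemma separated_disjoint X Q x : separated vertex_adj X Q -> x \in X -> x \notin Q.
Proof. by move=> sXQ xX; apply/negP => xQ; have := sXQ x x xX xQ; rewrite eqxx. Qed.

Lemma sum_class_split X Q s (F : config -> R) : separated vertex_adj X Q ->
  \sum_(t | same_off (X :|: Q) s t) F t =
  \sum_(v | same_off X s v) \sum_(t | same_off Q v t) F t.
Proof.
move=> sepXQ.
rewrite (partition_big (fun t => mix X t s) (same_off X s)) /=; last first.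
  by move=> t _; apply/same_offP => x xX; rewrite ffunE (negPf xX).
apply: eq_bigr => v /same_offP sv; apply: eq_bigl => t.
apply/andP/same_offP => [[/same_offP st /eqP <-] x xQ|vt].
  by rewrite ffunE; case: ifPn => // xX; rewrite st // inE negb_or xX.
split.
  by apply/same_offP => x; rewrite inE negb_or => /andP[xX xQ]; rewrite vt ?sv.
apply/eqP/ffunP => x; rewrite ffunE; case: ifPn => xX; last by rewrite sv.
by rewrite vt // (separated_disjoint sepXQ).
Qed.

Lemma class_mass_product X Q s u : separated vertex_adj X Q -> same_off X s u ->
  p u * class_mass (X :|: Q) s = class_mass X s * class_mass Q u.
Proof.
move=> sepXQ su; rewrite /class_mass (sum_class_split _ _ sepXQ).
rewrite mulr_sumr mulr_suml; apply: eq_bigr => v sv; rewrite !mulr_sumr.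
have uv : same_off X u v by apply: same_off_trans sv; rewrite same_off_sym.
have disj x := @separated_disjoint X Q x sepXQ.
rewrite (reindex_onto (fun w => mix X v w) (fun t => mix X u t)) /=; last first.
  move=> t /same_offP vt; apply/ffunP => x; rewrite !ffunE; case: (boolP (x \in X)) => // xX.
  by rewrite vt // disj.
apply: eq_big => w.
  apply/andP/same_offP => [[/same_offP vw /eqP <-] x xQ|uw].
    rewrite !ffunE; case: (boolP (x \in X)) => // xX.
    have := vw x xQ; rewrite ffunE (negPf xX) => ->.
    by move/same_offP: uv => ->.
  split.
    apply/same_offP => x xQ; rewrite ffunE; case: (boolP (x \in X)) => // xX.
    by rewrite uw //; move/same_offP: uv => ->.
  apply/eqP/ffunP => x; rewrite !ffunE; case: (boolP (x \in X)) => // xX.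
  by rewrite uw // disj.
move=> /andP[/same_offP vw /eqP wE].
rewrite mulrC (@gibbs_exchange X Q u); last 2 first.
- exact: sepXQ.
- apply/same_offP => x; rewrite inE negb_or => /andP[xX xQ].
  by rewrite vw //; move/same_offP: uv => ->.
congr (p _ * p _); last first.
  by rewrite -[RHS]wE; apply/ffunP => x; rewrite !ffunE; case: ifP.
apply/ffunP => x; rewrite !ffunE; case: (boolP (x \in X)) => // xX.
by move/same_offP: uv => ->.
Qed.

(** The conditional measure on [X :|: Q] is a product of those on [X] and [Q]. *)
Lemma cond_expect_product X Q f s : separated vertex_adj X Q -> 0 < p s ->
  mu X (mu Q f) s = mu (X :|: Q) f s.
Proof.
move=> sepXQ ps; rewrite !cond_expectE (sum_class_split _ _ sepXQ).
apply: eq_bigr => u su; rewrite cond_expectE mulr_sumr; apply: eq_bigr => t ut.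
have zX := class_mass_gt0 X ps; have zXQ := class_mass_gt0 (X :|: Q) ps.
have := class_mass_ge0 Q u; rewrite le_eqVlt => /predU1P[zQ|zQ].
  have -> : p t = 0.
    apply/eqP; rewrite eq_le gibbs_ge0 andbT.
    by apply: (le_trans (gibbs_le_mass ut)); rewrite -zQ.
  by rewrite !mul0r mulr0.
have E1 := class_mass_product sepXQ su.
have -> : p u = class_mass X s * class_mass Q u / class_mass (X :|: Q) s.
  by rewrite -E1 mulfK // gt_eqF.
by field; rewrite !gt_eqF.
Qed.

End Conditioning.

(** * Entropy *)

Section EntropyCalculus.
Variables (R : realType) (q : nat) (V dV : finType) (S : spinSystem R q V dV).
Hypothesis Omega_neq0 : Omega S != set0.
Local Notation config := (config q V).
Local Notation p := (gibbs S).
Local Notation E := (expect S).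
Local Notation mu := (cond_expect S).
Implicit Types (s t u v : config) (A B P Q X : {set V}) (f g h : config -> R).

Definition xlnx (x : R) : R := x * ln x.

Lemma ln_geVB1 (z : R) : 0 < z -> 1 - z^-1 <= ln z.
Proof.
move=> z0; have zV : 0 < z^-1 by rewrite invr_gt0.
have h : -1 < z^-1 - 1 by rewrite ltrBrDl subrr.
have := le_ln1Dx h; rewrite addrC subrK lnV ?posrE //.
by rewrite lerNl opprB.
Qed.

(** Joint convexity of [x * ln (x / y)], through its tangent at the pair of
    conditional expectations. *)
Lemma cond_log_sum B f g s : (forall t, 0 <= f t) -> (forall t, 0 <= g t) ->
  (forall t, 0 < p t -> 0 < f t -> 0 < g t) -> 0 < p s ->
  mu B f s * ln (mu B f s / mu B g s) <= mu B (fun t => f t * ln (f t / g t)) s.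
Proof.
move=> f0 g0 fg ps.
set a := mu B f s; set b := mu B g s.
have a0 : 0 <= a by apply: cond_expect_ge0.
have b0 : 0 <= b by apply: cond_expect_ge0.
pose tangent t := ln (a / b) * f t + f t + - (a / b) * g t.
have muT : mu B tangent s = a * ln (a / b) + a - a / b * b.
  by rewrite /tangent !cond_expectD !cond_expectZ -/a -/b mulNr mulrC.
have -> : a * ln (a / b) = mu B tangent s + (a / b * b - a) by rewrite muT; ring.
have le_ab : a / b * b <= a.
  have [->|bn] := eqVneq b 0; first by rewrite mulr0.
  by rewrite divfK.
apply: (@le_trans _ _ (mu B tangent s)); first by rewrite gerDl subr_le0.
apply: (cond_expect_le Omega_neq0) => t st pt; rewrite /tangent.
have := f0 t; rewrite le_eqVlt => /predU1P[<-|ft].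
  by rewrite mulr0 !mul0r !add0r mulNr oppr_le0 mulr_ge0 ?divr_ge0.
have gt := fg t pt ft.
have ap : 0 < a.
  rewrite /a (cond_expect_class _ _ st); exact: cond_expect_gt0.
have bp : 0 < b.
  rewrite /b (cond_expect_class _ _ st); exact: cond_expect_gt0.
have -> : f t / g t = (a / b) * ((f t / g t) / (a / b)).
  by rewrite [RHS]mulrC divfK // gt_eqF ?divr_gt0.
rewrite [X in _ <= _ * X]lnM ?posrE ?divr_gt0 // mulrDr [X in _ <= X + _]mulrC -addrA lerD2l.
have z0 : 0 < f t / g t / (a / b) by rewrite !divr_gt0.
apply: le_trans (ler_wpM2l (ltW ft) (ln_geVB1 z0)).
by rewrite le_eqVlt; apply/orP; left; apply/eqP; field; rewrite !gt_eqF.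
Qed.

Lemma mean_EntE B f : (forall t, 0 <= f t) ->
  mean_Ent S B f = E (fun s => xlnx (f s)) - E (fun s => xlnx (mu B f s)).
Proof.
move=> f0.
have -> : E (fun s => xlnx (mu B f s)) = E (fun s => f s * ln (mu B f s)).
  rewrite -[RHS](expect_cond Omega_neq0 B); apply: expect_eq => // s _.
  rewrite (@cond_expect_pull _ _ _ _ _ _ f (fun t => ln (mu B f t))) // => t st.
  by rewrite (cond_expect_class _ _ st).
rewrite -expectB //; apply: expect_eq => // s ps; rewrite /xlnx.
have := f0 s; rewrite le_eqVlt => /predU1P[<-|fs]; first by rewrite !mul0r subr0.
by rewrite ln_div ?posrE ?cond_expect_gt0 // mulrBr.
Qed.

Lemma Ent_mean f : Ent S f = mean_Ent S setT f.
Proof. by apply: expect_eq => // s _; rewrite (expectE _ _ s). Qed.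

Lemma mean_Ent_ge0 B f : (forall t, 0 <= f t) -> 0 <= mean_Ent S B f.
Proof.
move=> f0; rewrite /mean_Ent -(expect_cond Omega_neq0 B).
have -> : 0 = E (fun=> 0) by rewrite /expect big1 // => s _; rewrite mulr0.
apply: expect_le => // s ps.
have H := cond_log_sum B f0 (fun t => cond_expect_ge0 Omega_neq0 B t f0).

apply: le_trans (H _ _ ps); last by move=> t pt ft; apply: cond_expect_gt0.
rewrite cond_expect_tower //.
have := cond_expect_ge0 Omega_neq0 B s f0; rewrite le_eqVlt => /predU1P[<-|h].
  by rewrite mul0r.
by rewrite divff ?gt_eqF // ln1 mulr0.
Qed.

Lemma separated_sub (P Q X : {set V}) : P \subset Q ->
  separated (vertex_adj S) X Q -> separated (vertex_adj S) X P.
Proof. by move=> /subsetP sPQ sXQ x y xX yP; apply: sXQ => //; apply: sPQ. Qed.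

Lemma separatedC (P Q : {set V}) :
  separated (vertex_adj S) P Q -> separated (vertex_adj S) Q P.
Proof.
by move=> sPQ x y xQ yP; rewrite eq_sym vertex_adj_sym; apply: sPQ.
Qed.

(** The entropy gained by adding [X] to a set that it is not adjacent to is the
    block entropy on [X] of the partially averaged function. *)
Lemma mean_Ent_chain P X f : (forall t, 0 <= f t) ->
  separated (vertex_adj S) X P ->
  mean_Ent S (P :|: X) f - mean_Ent S P f = mean_Ent S X (mu P f).
Proof.
move=> f0 sXP; rewrite !mean_EntE => [|t|//|//]; last exact: cond_expect_ge0.
have -> : E (fun s => xlnx (mu X (mu P f) s)) =
          E (fun s => xlnx (mu (P :|: X) f s)).
  by apply: expect_eq => // s ps; rewrite cond_expect_product // setUC.
by ring.
Qed.

(** Diminishing increments come from averaging over the larger set [Q], which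
    commutes with the averages over [X], and joint convexity. *)
Lemma mean_Ent_entropy_like f : (forall t, 0 <= f t) ->
  entropy_like (vertex_adj S) (fun B => mean_Ent S B f).
Proof.
move=> f0; have muf0 B t : 0 <= mu B f t by apply: cond_expect_ge0.
split.
- rewrite mean_EntE // [X in _ - X](_ : _ = E (fun s => xlnx (f s))) ?subrr //.
  by apply: expect_eq => // s ps; rewrite cond_expect_set0.
- move=> A B sAB; rewrite -subr_ge0 !mean_EntE //.
  have -> : E (fun s => xlnx (f s)) - E (fun s => xlnx (mu B f s)) -
      (E (fun s => xlnx (f s)) - E (fun s => xlnx (mu A f s))) =
      mean_Ent S B (mu A f).
    rewrite mean_EntE //.
    have -> : E (fun s => xlnx (mu B (mu A f) s)) = E (fun s => xlnx (mu B f s)).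
      by apply: expect_eq => // s _; rewrite cond_expect_tower.
    by ring.
  exact: mean_Ent_ge0.
move=> P Q X sPQ sXQ; have sXP := separated_sub sPQ sXQ.
rewrite !mean_Ent_chain // /mean_Ent.
rewrite -[leRHS](expect_cond Omega_neq0 Q); apply: expect_le => // s ps.
have H := cond_log_sum Q (muf0 P) (fun t => cond_expect_ge0 Omega_neq0 X t (muf0 P)).

apply: le_trans (H _ _ ps); last first.
  by move=> t pt ft; apply: cond_expect_gt0.
rewrite (cond_expect_tower Omega_neq0 f s sPQ).
rewrite (cond_expect_product Omega_neq0 _ (separatedC sXQ)) //.
have -> : mu (Q :|: X) (mu P f) s = mu X (mu Q f) s.
  rewrite cond_expect_tower //; last by apply: subset_trans sPQ (subsetUl _ _).
  by rewrite cond_expect_product // setUC.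
exact: lexx.
Qed.

End EntropyCalculus.

(** * Comparison of entropy and variance *)

Section LocalInequality.
Variables (R : realType) (q : nat) (V dV : finType) (S : spinSystem R q V dV).
Hypothesis Omega_neq0 : Omega S != set0.
Local Notation config := (config q V).
Local Notation p := (gibbs S).
Local Notation E := (expect S).
Local Notation mu := (cond_expect S).
Implicit Types (s t u v : config) (A B C P Q X : {set V}) (f g h : config -> R).

(** The integrand of [mean_Ent], as a function of the configuration. *)
Definition block_dev B g : config -> R := fun s => g s * ln (g s / mu B g s).

(** The conditional mean is the best constant approximation in mean square. *)
Lemma cond_variance B h (c : R) s : 0 < p s ->
  mu B (fun t => (h t - mu B h t) ^+ 2) s <= mu B (fun t => (h t - c) ^+ 2) s.
Proof.
move=> ps; set a := mu B h s.
have -> : mu B (fun t => (h t - c) ^+ 2) s =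
    mu B (fun t => (h t - mu B h t) ^+ 2) s + (a - c) ^+ 2.
  have -> : mu B (fun t => (h t - mu B h t) ^+ 2) s =
            mu B (fun t => h t ^+ 2 + - (2 * a) * h t + a ^+ 2) s.
    apply: (cond_expect_eq Omega_neq0) => t st _.
    by rewrite -(cond_expect_class S h st) -/a; ring.
  have -> : mu B (fun t => (h t - c) ^+ 2) s =
            mu B (fun t => h t ^+ 2 + - (2 * c) * h t + c ^+ 2) s.
    by apply: (cond_expect_eq Omega_neq0) => t st _; ring.
  by rewrite !cond_expectD !cond_expectZ !cond_expect_cst // -/a; ring.
by rewrite lerDl sqr_ge0.
Qed.

Lemma ln_sq_ratio (x y : R) : 0 < x -> 0 < y ->
  ln (x / y) = 2 * ln (Num.sqrt x / Num.sqrt y).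
Proof.
move=> x0 y0.
rewrite -[in LHS](sqr_sqrtr (ltW x0)) -[in LHS](sqr_sqrtr (ltW y0)).
by rewrite -expr_div_n lnXn ?divr_gt0 ?sqrtr_gt0 // mulr_natl.
Qed.

(** A consequence of [ln z >= 1 - 1 / z] applied to [sqrt (g / mu g)]. *)
Lemma variance_sqrt_le_entropy B g s : (forall t, 0 <= g t) -> 0 < p s ->
  mu B (fun t => (Num.sqrt (g t) - mu B (fun u => Num.sqrt (g u)) t) ^+ 2) s
    <= mu B (block_dev B g) s.
Proof.
move=> g0 ps; set h := fun u => Num.sqrt (g u).
set m := mu B g s; set r := Num.sqrt m.
have m0 : 0 <= m by apply: cond_expect_ge0.
apply: (le_trans (cond_variance B h r ps)).
have -> : mu B (fun t => (h t - r) ^+ 2) s =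
          mu B (fun t => 2 * g t + - (2 * r) * h t) s.
  have -> : mu B (fun t => (h t - r) ^+ 2) s =
            mu B (fun t => g t + - (2 * r) * h t + r ^+ 2) s.
    apply: (cond_expect_eq Omega_neq0) => t st _.
    by rewrite -[in RHS](sqr_sqrtr (g0 t)) -/(h t); ring.
  have rE : r ^+ 2 = m by rewrite sqr_sqrtr.
  by rewrite !cond_expectD cond_expect_cst // !cond_expectZ -/m rE; ring.
apply: (cond_expect_le Omega_neq0) => t st pt; rewrite /block_dev.
rewrite -(cond_expect_class S g st) -/m.
have := g0 t; rewrite le_eqVlt => /predU1P[gt|gt].
  by rewrite /h -gt sqrtr0 mul0r !mulr0 addr0.
have mp : 0 < m by rewrite /m (cond_expect_class S g st); apply: cond_expect_gt0.
have rp : 0 < r by rewrite sqrtr_gt0.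
have hp : 0 < h t by rewrite sqrtr_gt0.
rewrite ln_sq_ratio // -/r -/(h t).
have := ln_geVB1 (divr_gt0 hp rp); rewrite invf_div => le_ln.
rewrite mulrCA; apply: le_trans (_ : 2 * (g t * (1 - r / h t)) <= _); last first.
  by rewrite ler_pM2l // ler_pM2l.
rewrite le_eqVlt; apply/orP; left; apply/eqP.
rewrite -(sqr_sqrtr (ltW gt)) -/(h t); field.
by rewrite gt_eqF.
Qed.

(** The pointwise form of [entropy_le_variance_sqrt], where [a] is the mean of
    the square root [h]. *)
Lemma entropy_term_bound (h a L : R) : 0 <= h -> 0 < a -> 0 <= L ->
  ln (h / a) <= L ->
  h ^+ 2 * ln (h ^+ 2 / a ^+ 2) - h ^+ 2 + a ^+ 2 <= (3 + 2 * L) * (h - a) ^+ 2.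
Proof.
move=> h0 a0 L0 leL.
have := h0; rewrite le_eqVlt => /predU1P[<-|hp].
  rewrite !expr0n /= !mul0r subr0 add0r sub0r sqrrN.
  have := sqr_ge0 a; nra.
have zp : 0 < h / a by rewrite divr_gt0.
rewrite -expr_div_n lnXn // -(mulr_natl (ln _)).
have le_u : ln (h / a) <= h / a - 1.
  have := @le_ln1Dx R (h / a - 1); rewrite subrKC; apply.
  by rewrite ltrBrDl subrr.
have le_u' : a * ln (h / a) <= h - a.
  have -> : h - a = a * (h / a - 1) by field; rewrite gt_eqF.
  by rewrite ler_pM2l.
set l := ln (h / a) in leL le_u le_u' *.
have [lha|lah] := leP h a.
  have E1 : a * (h ^+ 2 * (2%:R * l) - h ^+ 2 + a ^+ 2) <= a * (3 * (h - a) ^+ 2).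
    have h1 : h ^+ 2 * (a * l) <= h ^+ 2 * (h - a) by rewrite ler_wpM2l ?sqr_ge0.
    have h2 : 0 <= (a - h) * (h - a) ^+ 2 by rewrite mulr_ge0 ?sqr_ge0 ?subr_ge0.
    have -> : a * (h ^+ 2 * (2%:R * l) - h ^+ 2 + a ^+ 2) =
              2 * (h ^+ 2 * (a * l)) - a * h ^+ 2 + a ^+ 3 by ring.
    nra.
  have E2 : h ^+ 2 * (2%:R * l) - h ^+ 2 + a ^+ 2 <= 3 * (h - a) ^+ 2.
    by move: E1; rewrite ler_pM2l.
  apply: (le_trans E2); apply: ler_wpM2r; first exact: sqr_ge0.
  by rewrite lerDl mulr_ge0.
have h1 : (h - a) ^+ 2 * l <= (h - a) ^+ 2 * L by rewrite ler_wpM2l ?sqr_ge0.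
have h2 : (2 * h - a) * (a * l) <= (2 * h - a) * (h - a).
  by rewrite ler_wpM2l //; lra.
have -> : h ^+ 2 * (2%:R * l) = 2 * ((h - a) ^+ 2 * l) + 2 * ((2 * h - a) * (a * l)).
  by ring.
nra.
Qed.

(** A crude logarithmic Sobolev inequality: when all conditional probabilities
    are at least [beta], the entropy of [g] exceeds the variance of [sqrt g] by
    a factor at most [3 + 2 ln (1 / beta)]. *)
Lemma entropy_le_variance_sqrt B g s (beta : R) : (forall t, 0 <= g t) -> 0 < p s ->
  0 < beta -> (forall t, same_off B s t -> 0 < p t -> beta <= p t / class_mass S B s) ->
  mu B (block_dev B g) s <= (3 + 2 * ln beta^-1) *
   mu B (fun t => (Num.sqrt (g t) - mu B (fun u => Num.sqrt (g u)) t) ^+ 2) s.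
Proof.
move=> g0 ps b0 bmin; set h := fun u => Num.sqrt (g u).
set m := mu B g s; set a := mu B h s.
have h0 t : 0 <= h t by apply: sqrtr_ge0.
have m0 : 0 <= m by apply: cond_expect_ge0.
have a0 : 0 <= a by apply: cond_expect_ge0.
have L0 : 0 <= ln beta^-1.
  apply: ln_ge0; rewrite invf_ge1 //; apply: (le_trans (bmin s (same_off_refl _ _) ps)).
  by rewrite ler_pdivrMr ?class_mass_gt0 // mul1r gibbs_le_mass ?same_off_refl.
have hle t : same_off B s t -> 0 < p t -> h t * beta <= a.
  move=> st pt; rewrite /a cond_expectE (bigD1 t) //=.
  rewrite -[leLHS]addr0; apply: lerD.
    by rewrite mulrC ler_wpM2r ?bmin.
  by apply: sumr_ge0 => u _; rewrite mulr_ge0 // divr_ge0 ?gibbs_ge0 ?class_mass_ge0.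
have -> : mu B (fun t => (h t - mu B h t) ^+ 2) s = mu B (fun t => (h t - a) ^+ 2) s.
  by apply: (cond_expect_eq Omega_neq0) => t st _; rewrite -(cond_expect_class S h st).
have [a_eq0|a_neq0] := eqVneq a 0.
  rewrite -cond_expectZ; apply: (cond_expect_le Omega_neq0) => t st pt.
  have ht : h t = 0.
    apply/eqP; rewrite eq_le h0 andbT -(pmulr_lle0 _ b0) -a_eq0; exact: hle.
  rewrite /block_dev -(sqr_sqrtr (g0 t)) -/(h t) ht a_eq0 subr0 expr0n /=.
  by rewrite mul0r mulr0.
have ap : 0 < a by rewrite lt_def a_neq0.
have mp : 0 < m.
  rewrite lt_def m0 andbT; apply: contraNneq a_neq0 => m_eq0.
  rewrite /a cond_expectE big1 // => t st.
  have := gibbs_ge0 Omega_neq0 t; rewrite le_eqVlt => /predU1P[<-|pt].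
    by rewrite !mul0r.
  have gt : g t = 0.
    apply/eqP; rewrite eq_le g0 andbT leNgt; apply/negP => gt.
    have := cond_expect_gt0 Omega_neq0 B g0 pt gt.
    by rewrite -(cond_expect_class S g st) -/m m_eq0 ltxx.
  by rewrite /h gt sqrtr0 mulr0.
(* the entropy is smallest for the reference value [m], so that [m] can be
   replaced by [a ^+ 2] *)
have -> : mu B (block_dev B g) s =
          mu B (fun t => g t * ln (g t / a ^+ 2) + - ln (m / a ^+ 2) * g t) s.
  apply: (cond_expect_eq Omega_neq0) => t st pt.
  rewrite /block_dev -(cond_expect_class S g st) -/m.
  have := g0 t; rewrite le_eqVlt => /predU1P[<-|gt]; first by rewrite !(mul0r,mulr0) addr0.
  by rewrite !ln_div ?posrE ?exprn_gt0 //; ring.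
rewrite cond_expectD cond_expectZ -/m.
have le1 : m - a ^+ 2 <= ln (m / a ^+ 2) * m.
  have z0 : 0 < m / a ^+ 2 by rewrite divr_gt0 ?exprn_gt0.
  have -> : m - a ^+ 2 = (1 - (m / a ^+ 2)^-1) * m.
    by field; rewrite !gt_eqF ?exprn_gt0.
  by rewrite ler_pM2r // ln_geVB1.
apply: (@le_trans _ _ (mu B (fun t => g t * ln (g t / a ^+ 2) + - 1 * g t + a ^+ 2) s)).
  by rewrite !cond_expectD cond_expect_cst // cond_expectZ -/m; lra.
rewrite -cond_expectZ; apply: (cond_expect_le Omega_neq0) => t st pt.
have := @entropy_term_bound (h t) a (ln beta^-1) (h0 t) ap L0.
rewrite sqr_sqrtr // mulN1r; apply.
have := h0 t; rewrite le_eqVlt => /predU1P[<-|hp]; first by rewrite mul0r ln0.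
rewrite ler_ln ?posrE ?divr_gt0 ?invr_gt0 //.
by rewrite ler_pdivrMr // ler_pdivlMl // mulrC hle.
Qed.

End LocalInequality.

(** * Factorization of entropy on a small block *)

Section Paths.
Variables (R : realType).

(** If the oscillation of [h] along an edge is controlled by a potential [D] at
    both ends, its oscillation along a path is controlled by the sum of [D]. *)
Lemma path_oscillation (T : eqType) (e : rel T) (h D : T -> R) (x : T) (s : seq T) :
  (forall u, 0 <= D u) -> (forall u v, e u v -> `|h v - h u| <= D u + D v) ->
  path e x s -> `|h (last x s) - h x| <= D x + 2 * \sum_(u <- s) D u.
Proof.
move=> D0 step; elim: s x => [|y s IH] x /= => [_|/andP[exy ys]].
  by rewrite big_nil mulr0 addr0 subrr normr0.
rewrite big_cons; apply: (le_trans (ler_distD (h y) _ _)).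
have := IH y ys; have := step x y exy; lra.
Qed.

(** The Cauchy-Schwarz inequality against the constant function. *)
Lemma sum_sqr_le (T : finType) (A : {set T}) (D : T -> R) :
  (\sum_(u in A) D u) ^+ 2 <= #|A|%:R * \sum_(u in A) D u ^+ 2.
Proof.
have [->|A0] := eqVneq A set0; first by rewrite !big_set0 expr0n mulr0.
have N0 : 0 < #|A|%:R :> R by rewrite ltr0n card_gt0.
set t := \sum_(u in A) D u.
have : 0 <= \sum_(u in A) (#|A|%:R * D u - t) ^+ 2 by apply: sumr_ge0 => u _; apply: sqr_ge0.
have -> : \sum_(u in A) (#|A|%:R * D u - t) ^+ 2 =
          #|A|%:R * (#|A|%:R * (\sum_(u in A) D u ^+ 2) - t ^+ 2).
  have -> : \sum_(u in A) (#|A|%:R * D u - t) ^+ 2 =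
      \sum_(u in A) (#|A|%:R ^+ 2 * D u ^+ 2 - (2 * #|A|%:R * t) * D u + t ^+ 2).
    by apply: eq_bigr => u _; ring.
  by rewrite big_split sumrB /= sumr_const -(mulr_natl (t ^+ 2)) -!mulr_sumr -/t; ring.
by rewrite pmulr_rge0 // subr_ge0.
Qed.

End Paths.

Section LocalConstant.
Variables (R : realType) (b : R).
Hypotheses (b_gt0 : 0 < b) (b1 : b <= 1).

(** The cost of factorizing the entropy of a block of [m] vertices over the
    colour classes in a [b]-marginally bounded system. *)
Definition local_const (m : nat) : R :=
  4 * (3 + 2 * (m%:R * ln b^-1)) * b^-1 ^+ (2 * m).

Lemma local_const_ge0 m : 0 <= local_const m.
Proof.
have lnb0 : 0 <= ln b^-1 by rewrite ln_ge0 // invf_ge1.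
by rewrite /local_const !mulr_ge0 ?exprn_ge0 ?invr_ge0 ?(ltW b_gt0) // addr_ge0 // !mulr_ge0.
Qed.

Lemma local_const_mono : {homo local_const : m n / (m <= n)%N >-> m <= n}.
Proof.
move=> m n mn; have lnb0 : 0 <= ln b^-1 by rewrite ln_ge0 // invf_ge1.
have bV1 : 1 <= b^-1 by rewrite invf_ge1.
rewrite /local_const; apply: ler_pM.
- by rewrite mulr_ge0 // addr_ge0 // !mulr_ge0.
- by rewrite exprn_ge0 // invr_ge0 ltW.
- rewrite ler_pM2l // lerD2l ler_pM2l // ler_wpM2r //.
  by rewrite ler_nat.
- by apply: ler_weXn2l => //; rewrite leq_mul2l.
Qed.

End LocalConstant.

Section LocalFactorization.
Variables (R : realType) (q : nat) (V dV : finType) (S : spinSystem R q V dV).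
Variables (b : R) (k : nat) (c : V -> 'I_k).
Hypothesis Omega_neq0 : Omega S != set0.
Hypothesis connS : totally_connected S.
Hypothesis margS : marginally_bounded S b.
Local Notation config := (config q V).
Local Notation p := (gibbs S).
Local Notation E := (expect S).
Local Notation mu := (cond_expect S).
Implicit Types (s t u v : config) (A B C P Q X : {set V}) (f g h : config -> R).

Let b_gt0 : 0 < b. Proof. by case: margS. Qed.

Lemma pinning_self U s : 0 < p s -> pinning S U s.
Proof.
rewrite gibbs_gt0 // => sO; apply/existsP; exists s; rewrite sO.
by apply/forallP => x; rewrite eqxx implybT.
Qed.

Lemma cond_gibbsE C s t :
  cond_gibbs S (~: C) s t = if same_off C s t then p t / class_mass S C s else 0.
Proof. by []. Qed.

Lemma mem_cond_support C s t : 0 < p s ->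
  (t \in cond_support S (~: C) s) = same_off C s t && (0 < p t).
Proof.
move=> ps; rewrite inE cond_gibbsE; case: ifP => _; last by rewrite ltxx.
by rewrite pmulr_lgt0 // invr_gt0 class_mass_gt0.
Qed.

(** A block of [m] vertices, revealed one vertex at a time, takes any of its
    possible values with conditional probability at least [b ^ m]. *)
Lemma local_min C s : 0 < p s -> b ^+ #|C| <= p s / class_mass S C s.
Proof.
move=> ps; have [n] := ubnP #|C|; elim: n C => // n IH C ltCn.
have [->|[x xC]] := set_0Vmem C.
  have -> : class_mass S set0 s = p s.
    rewrite /class_mass (big_pred1 s) // => t.
    apply/same_offP/eqP => [st|-> //].
    by apply/ffunP => x; rewrite st ?inE.
  by rewrite cards0 divff // gt_eqF.
have zC : 0 < class_mass S C s by apply: class_mass_gt0.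
set C' := C :\ x; have zC' : 0 < class_mass S C' s by apply: class_mass_gt0.
have cC : #|C| = #|C'|.+1 by rewrite (cardsD1 x) xC.
have -> : p s / class_mass S C s =
   (class_mass S C' s / class_mass S C s) * (p s / class_mass S C' s).
  by field; rewrite !gt_eqF.
rewrite cC exprS; apply: ler_pM.
- exact: ltW.
- by rewrite exprn_ge0 ?ltW.
- have [_ /(_ (~: C) s (pinning_self _ ps) x (s x)) bnd] := margS.
  apply: le_trans (bnd _) _.
    by apply/imsetP; exists s; rewrite // mem_cond_support // same_off_refl.
  rewrite le_eqVlt; apply/orP; left; apply/eqP.
  under eq_bigr do rewrite cond_gibbsE.
  rewrite -big_mkcondr /= -mulr_suml; congr (_ / _); apply: eq_bigl => t.
  apply/andP/same_offP => [[/eqP tx /same_offP st] y|st].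
    by rewrite !inE negb_and negbK => /orP[/eqP ->|/st].
  split; first by rewrite st // !inE eqxx.
  by apply/same_offP => y yC; rewrite st // !inE negb_and yC orbT.
- by apply: IH; rewrite -ltnS -cC.
Qed.

Local Notation cls := (colour_class c).

(** The variance on a block [C] is bounded by its conditional variances on the
    colour classes. Two configurations are joined by a simple path of single
    spin changes, along which [h] moves by at most twice the sum of its
    distances [D] to the conditional means; the path has at most [b ^- #|C|]
    vertices, each of probability at least [b ^+ #|C|]. *)
Lemma local_variance C h s : 0 < p s ->
  mu C (fun t => (h t - mu C h t) ^+ 2) s <=
  4 * b^-1 ^+ (2 * #|C|) *
    \sum_j mu C (fun t => (h t - mu (C :&: cls j) h t) ^+ 2) s.
Proof.
move=> ps; set beta := b ^+ #|C|.
have beta0 : 0 < beta by rewrite exprn_gt0.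
have betaE : b^-1 ^+ (2 * #|C|) = beta^-1 ^+ 2.
  by rewrite mulnC exprM exprVn.
pose D2 t := \sum_j (h t - mu (C :&: cls j) h t) ^+ 2.
pose D t := Num.sqrt (D2 t).
have D20 t : 0 <= D2 t by apply: sumr_ge0 => j _; apply: sqr_ge0.
have D0 t : 0 <= D t by apply: sqrtr_ge0.
have D2E t : D t ^+ 2 = D2 t by rewrite sqr_sqrtr.
pose A := cond_support S (~: C) s.
have memA t : (t \in A) = same_off C s t && (0 < p t) by apply: mem_cond_support.
have minA t : t \in A -> beta <= p t / class_mass S C s.
  by rewrite memA => /andP[st pt]; rewrite (class_mass_eq S st) local_min.
have sumA (F : config -> R) : (forall t, 0 <= F t) ->
    beta * \sum_(t in A) F t <= mu C F s.
  move=> F0; rewrite cond_expectE mulr_sumr [leLHS]big_mkcond [leRHS]big_mkcond /=.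
  apply: ler_sum => t _; have [tA|_] := boolP (t \in A).
    have -> : same_off C s t by move: tA; rewrite memA => /andP[].
    by rewrite ler_wpM2r ?minA.
  by case: ifP => // _; rewrite mulr_ge0 // divr_ge0 ?gibbs_ge0 ?class_mass_ge0.
have cardA : #|A|%:R <= beta^-1.
  rewrite -[leRHS]mul1r ler_pdivlMr // mulrC.
  have := sumA (fun=> 1) (fun=> ler01); rewrite cond_expect_cst //.
  by rewrite sumr_const.
have osc t : t \in A -> `|h t - h s| <= 2 * \sum_(u in A) D u.
  move=> tA; have sA : s \in A by rewrite memA same_off_refl.
  have := connS (pinning_self (~: C) ps) sA tA.
  case/connectP => p0 path0 ->; case/shortenP: path0 => p1 path1 uniq1 _.
  move: path1; set e := (X in path X _ _) => path1.
  (* the path is simple, so that the sum over its vertices is at most that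
     over the whole support [A] *)
  have inA : {subset s :: p1 <= A}.
    move=> u; rewrite inE => /predU1P[->//|].
    elim: p1 (s) path1 {uniq1} => //= y p2 IH z /andP[+ path2].
    rewrite /e /= => /and3P[_ yA _].
    by rewrite inE => /predU1P[-> //|]; apply: IH path2.
  apply: (le_trans (path_oscillation D0 _ path1)).
    move=> u v; rewrite /e /= => /and3P[uA vA /cards1P[x xE]].
    have diff y : (u y != v y) = (y == x).
      by have := in_set1 y x; rewrite -xE inE.
    have xC : x \in C.
      apply/negPn/negP => xC; move: uA vA; rewrite !memA.
      move=> /andP[/same_offP /(_ x xC) ux _] /andP[/same_offP /(_ x xC) vx _].
      by have := diff x; rewrite ux vx !eqxx.
    have uv : same_off (C :&: cls (c x)) u v.
      apply/same_offP => y yC; apply/eqP; rewrite eq_sym.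
      have := diff y; case: (y =P x) => [yx|_ /negbFE //].
      by rewrite yx !inE xC eqxx in yC.
    have dist w : `|h w - mu (C :&: cls (c x)) h w| <= D w.
      rewrite -sqrtr_sqr ler_sqrt // /D2 (bigD1 (c x)) //= lerDl.
      by apply: sumr_ge0 => j _; apply: sqr_ge0.
    apply: (le_trans (ler_distD (mu (C :&: cls (c x)) h v) _ _)).
    rewrite addrC {1}[mu _ h v](_ : _ = mu (C :&: cls (c x)) h u); last first.
      by rewrite (cond_expect_class S h uv).
    by apply: lerD; rewrite ?dist // distrC dist.
  apply: (@le_trans _ _ (2 * \sum_(u <- s :: p1) D u)).
    by rewrite big_cons mulrDr lerD2r; have := D0 s; lra.
  rewrite ler_pM2l // big_uniq //= [leLHS]big_mkcond [leRHS]big_mkcond /=.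
  apply: ler_sum => u _; case: ifP => [/inA ->//|_]; by case: ifP.
have osc2 t : same_off C s t -> 0 < p t ->
    (h t - h s) ^+ 2 <= 4 * beta^-1 ^+ 2 * mu C D2 s.
  move=> st pt; have tA : t \in A by rewrite memA st.
  rewrite -real_normK ?num_real //.
  apply: (@le_trans _ _ ((2 * \sum_(u in A) D u) ^+ 2)).
    by rewrite lerXn2r ?nnegrE ?mulr_ge0 ?sumr_ge0 // osc.
  rewrite exprMn -[leRHS]mulrA.
  have -> : 2 ^+ 2 = 4 :> R by ring.
  rewrite ler_pM2l //; apply: (le_trans (sum_sqr_le A D)).
  rewrite expr2 -mulrA; apply: ler_pM => //.
    by apply: sumr_ge0 => u _; apply: sqr_ge0.
  rewrite ler_pdivlMl //; under eq_bigr do rewrite D2E.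
  exact: sumA.
have -> : \sum_j mu C (fun t => (h t - mu (C :&: cls j) h t) ^+ 2) s = mu C D2 s.
  by rewrite /D2 cond_expect_sum.
rewrite betaE; apply: (le_trans (cond_variance Omega_neq0 C h (h s) ps)).
rewrite -[leRHS](cond_expect_cst Omega_neq0 C _ ps).
by apply: (cond_expect_le Omega_neq0) => t; apply: osc2.
Qed.

Lemma local_factorization C g : b <= 1 -> (forall t, 0 <= g t) ->
  mean_Ent S C g <= local_const b #|C| * \sum_j mean_Ent S (C :&: cls j) g.
Proof.
move=> b1 g0; have lnb0 : 0 <= ln b^-1 by rewrite ln_ge0 // invf_ge1.
have -> : local_const b #|C| * \sum_j mean_Ent S (C :&: cls j) g =
    E (fun s => local_const b #|C| * \sum_j mu C (block_dev S (C :&: cls j) g) s).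
  have [s0 _] := set0Pn _ Omega_neq0.
  rewrite (expectE Omega_neq0 _ s0) cond_expectZ cond_expect_sum.
  congr (_ * _); apply: eq_bigr => j _.
  by rewrite -(expectE Omega_neq0) expect_cond.
rewrite /mean_Ent -(expect_cond Omega_neq0 C); apply: (expect_le Omega_neq0) => s ps.
have beta0 : 0 < b ^+ #|C| by rewrite exprn_gt0.
have minC t : same_off C s t -> 0 < p t -> b ^+ #|C| <= p t / class_mass S C s.
  by move=> st pt; rewrite (class_mass_eq S st) local_min.
apply: (le_trans (entropy_le_variance_sqrt Omega_neq0 g0 ps beta0 minC)).
have -> : ln (b ^+ #|C|)^-1 = #|C|%:R * ln b^-1.
  by rewrite -exprVn lnXn ?invr_gt0 // mulr_natl.
have c0 : 0 <= 3 + 2 * (#|C|%:R * ln b^-1) by rewrite addr_ge0 // !mulr_ge0.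
apply: (le_trans (ler_wpM2l c0 (local_variance C _ ps))).
rewrite /local_const [leLHS]mulrA.
have -> : (3 + 2 * (#|C|%:R * ln b^-1)) * (4 * b^-1 ^+ (2 * #|C|)) =
  4 * (3 + 2 * (#|C|%:R * ln b^-1)) * b^-1 ^+ (2 * #|C|) by ring.
apply: ler_wpM2l.
  by rewrite !mulr_ge0 ?exprn_ge0 ?invr_ge0 ?(ltW b_gt0).
apply: ler_sum => j _.
rewrite -[leLHS](cond_expect_tower Omega_neq0 _ _ (subsetIl C (cls j))).
rewrite -[leRHS](cond_expect_tower Omega_neq0 _ _ (subsetIl C (cls j))).
apply: (cond_expect_le Omega_neq0) => t _ pt.
exact: variance_sqrt_le_entropy.
Qed.

(** [local_factorization] in the presence of a set [Q] already averaged over. *)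
Lemma local_increment C Q f : b <= 1 -> (forall t, 0 <= f t) ->
  separated (vertex_adj S) C Q ->
  mean_Ent S (Q :|: C) f - mean_Ent S Q f <=
  local_const b #|C| * \sum_j (mean_Ent S ((Q :|: C) :&: cls j) f
                             - mean_Ent S (Q :&: cls j) f).
Proof.
move=> b1 f0 sCQ; have el := mean_Ent_entropy_like Omega_neq0 f0.
rewrite mean_Ent_chain //.
have g0 t : 0 <= mu Q f t by apply: cond_expect_ge0.
apply: (le_trans (local_factorization C b1 g0)).
apply: ler_wpM2l; first exact: local_const_ge0.
apply: ler_sum => j _.
have sub : separated (vertex_adj S) (C :&: cls j) Q.
  by move=> x y; rewrite inE => /andP[xC _]; apply: sCQ.
rewrite -mean_Ent_chain // setIUl.
exact: (el_dim el (subsetIl Q (cls j)) sub).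
Qed.

End LocalFactorization.

(** * Colouring, degrees and the cluster series *)

Section Colouring.
Variables (V : finType) (e : rel V) (Delta : nat).
Hypothesis e_sym : symmetric e.
Hypothesis e_irr : irreflexive e.
Hypothesis e_deg : forall x, (#|[set y | e x y]| <= Delta)%N.

Lemma greedy_colouring :
  exists c : V -> 'I_Delta.+1, forall x y, e x y -> c x != c y.
Proof.
suff col (A : {set V}) : exists c : V -> 'I_Delta.+1,
    forall x y, x \in A -> y \in A -> e x y -> c x != c y.
  by have [c cP] := col setT; exists c => x y; apply: cP; rewrite inE.
have [n] := ubnP #|A|; elim: n A => // n IH A ltAn.
have [->|[x xA]] := set_0Vmem A; first by exists (fun=> ord0) => x y; rewrite inE.
have [|c cP] := IH (A :\ x); first by move: ltAn; rewrite (cardsD1 x) xA.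
have [i iN] : exists i, i \notin c @: [set y | e x y].
  have : (#|c @: [set y | e x y]| < #|'I_Delta.+1|)%N.
    by rewrite card_ord ltnS; apply: leq_trans (leq_imset_card _ _) (e_deg x).
  case: (pickP [pred i | i \notin c @: [set y | e x y]]) => [i iN _|all_in].
    by exists i.
  rewrite ltnNge => /negP[]; apply/subset_leq_card/subsetP => i _.
  by have /negbFE := all_in i.
exists (fun y => if y == x then i else c y) => u v uA vA euv.
have fresh w : e x w -> i != c w.
  by move=> xw; apply: contraNneq iN => ->; apply: imset_f; rewrite inE.
case: (eqVneq u x) => [ux|ux]; case: (eqVneq v x) => [vx|vx].
- by rewrite ux vx e_irr in euv.
- by apply: fresh; rewrite -ux.
- by rewrite eq_sym; apply: fresh; rewrite -vx e_sym.
- by apply: cP; rewrite // !inE ?ux ?vx.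
Qed.

End Colouring.

Lemma degree_bound (R : realType) (q : nat) (V dV : finType)
    (S : spinSystem R q V dV) (x : V) :
  (#|[set y | vertex_adj S x y]| <= max_degree S)%N.
Proof.
rewrite -(card_imset _ (@inl_inj V dV)).
apply: leq_trans (leq_bigmax (inl x : V + dV)%type).
apply/subset_leq_card/subsetP => _ /imsetP[y yN ->].
by move: yN; rewrite !inE.
Qed.

Section Numerics.
Variable R : realType.

Lemma geometric_sum_le (n : nat) : \sum_(r < n) (2 / 3 : R) ^+ r <= 3.
Proof.
have -> : \sum_(r < n) (2 / 3 : R) ^+ r = 3 * (1 - (2 / 3) ^+ n).
  elim: n => [|n IH]; first by rewrite big_ord0 expr0 subrr mulr0.
  by rewrite big_ord_recr /= IH exprS; field.
have : 0 <= (2 / 3 : R) ^+ n by rewrite exprn_ge0 // divr_ge0.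
lra.
Qed.

(** The linear factor in the size of a cluster is absorbed at ratio [4 / 3]. *)
Lemma succ_le_pow (r : nat) : 1 + r%:R <= 3 * (4 / 3 : R) ^+ r.
Proof.
suff h : 3 + r%:R <= 3 * (4 / 3 : R) ^+ r by apply: le_trans h; lra.
elim: r => [|r IH]; first by rewrite expr0 mulr0n addr0 mulr1.
have : 0 <= r%:R :> R by [].
rewrite exprS -(natr1 r); lra.
Qed.

Lemma ln_inv_ge (b : R) : 0 < b -> b <= 1 / 2 -> 1 / 2 <= ln b^-1.
Proof.
move=> b0 b2; have := @ln_geVB1 R b^-1; rewrite invr_gt0 invrK => /(_ b0).
lra.
Qed.

(** Under the condition on [theta] the cost [b ^ (- 2 (Delta + 1) r)] of the
    clusters with [r] vertices is beaten by the product of their number and of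
    their probability, leaving a factor [2 ^ (- r)]. *)
Lemma cluster_series_bound (b theta : R) (Delta n l : nat) :
  0 < b -> b <= 1 / 2 -> (0 < Delta)%N -> (0 < n)%N -> 0 < theta ->
  theta * (4 * expR 1 * Delta%:R ^+ 2) <= b ^+ (2 * (Delta + 1)) ->
  l%:R / n%:R <= 2 * theta ->
  forall N : nat,
  \sum_(r < N) (expR 1 * (expR 1 * (Delta ^ 2)%:R) ^+ r
     * local_const b (1 + Delta.+1 * r) * (l%:R / n%:R) ^+ r)
  <= 864 * expR 1 * Delta%:R * ln b^-1 * b^-1 ^+ 2.
Proof.
move=> b0 b2 D0 n0 th0 hth hl N.
have e0 : 0 < expR 1 :> R by apply: expR_gt0.
have lam := ln_inv_ge b0 b2.
have B0 : 0 < b^-1 by rewrite invr_gt0.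
set X := b ^+ (2 * (Delta + 1)) in hth.
have X0 : 0 < X by rewrite exprn_gt0.
have D1 : 1 <= Delta%:R :> R by rewrite ler1n.
have ln0 : 0 <= l%:R / n%:R :> R by rewrite divr_ge0.
pose c := 32 * expR 1 * ln b^-1 * b^-1 ^+ 2 * (3 * (Delta%:R + 2)).
have c0 : 0 <= c.
  by rewrite /c !mulr_ge0 ?exprn_ge0 ?addr_ge0 ?(ltW B0) ?(ltW e0) //; lra.
apply: (@le_trans _ _ (\sum_(r < N) c * (2 / 3) ^+ r)); last first.
  rewrite -mulr_sumr; apply: (le_trans (ler_wpM2l c0 (geometric_sum_le N))).
  rewrite /c.
  have w0 : 0 <= expR 1 * ln b^-1 * b^-1 ^+ 2.
    by rewrite !mulr_ge0 ?exprn_ge0 ?(ltW B0) ?(ltW e0) //; lra.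
  have -> : 32 * expR 1 * ln b^-1 * b^-1 ^+ 2 * (3 * (Delta%:R + 2)) * 3 =
            (expR 1 * ln b^-1 * b^-1 ^+ 2) * (288 * (Delta%:R + 2)) by ring.
  have -> : 864 * expR 1 * Delta%:R * ln b^-1 * b^-1 ^+ 2 =
            (expR 1 * ln b^-1 * b^-1 ^+ 2) * (864 * Delta%:R) by ring.
  by apply: ler_wpM2l => //; lra.
apply: ler_sum => r _; move: (r : nat) => {}r.
set m := (1 + Delta.+1 * r)%N.
have mE : m%:R = 1 + (Delta%:R + 1) * r%:R :> R.
  by rewrite /m natrD natrM -(natr1 Delta).
have m1 : 1 <= m%:R :> R by rewrite ler1n.
have r0 : 0 <= r%:R :> R by [].
(* as [ln b^-1 >= 1 / 2] and [m >= 1], the constant 3 is at most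
   [6 * m * ln b^-1] *)
have loc : local_const b m <= 32 * ln b^-1 * m%:R * (b^-1 ^+ 2 * X^-1 ^+ r).
  have -> : b^-1 ^+ 2 * X^-1 ^+ r = b^-1 ^+ (2 * m).
    by rewrite /X -exprVn -exprM -exprD; congr (_ ^+ _); rewrite /m; ring.
  apply: ler_wpM2r; first by rewrite exprn_ge0 ?(ltW B0).
  have : 1 / 2 <= m%:R * ln b^-1 by nra.
  lra.
have loc0 : 0 <= local_const b m by apply: local_const_ge0 => //; lra.
have eD0 : 0 <= expR 1 * (Delta ^ 2)%:R :> R by rewrite mulr_ge0 ?(ltW e0).
have half : expR 1 * (Delta ^ 2)%:R * X^-1 * (2 * theta) <= 1 / 2.
  rewrite mulrAC ler_pdivrMr //.
  by rewrite natrX; lra.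
apply: (@le_trans _ _ (expR 1 * (expR 1 * (Delta ^ 2)%:R) ^+ r
     * (32 * ln b^-1 * m%:R * (b^-1 ^+ 2 * X^-1 ^+ r)) * (2 * theta) ^+ r)).
  apply: ler_pM.
  - by rewrite mulr_ge0 ?loc0 // mulr_ge0 ?exprn_ge0 ?(ltW e0).
  - exact: exprn_ge0.
  - by apply: ler_wpM2l => //; rewrite mulr_ge0 ?exprn_ge0 ?(ltW e0).
  - by apply: lerXn2r; rewrite ?nnegrE //; lra.
have w0 : 0 <= 32 * expR 1 * ln b^-1 * b^-1 ^+ 2.
  by rewrite !mulr_ge0 ?exprn_ge0 ?(ltW B0) ?(ltW e0) //; lra.
have -> : expR 1 * (expR 1 * (Delta ^ 2)%:R) ^+ r
     * (32 * ln b^-1 * m%:R * (b^-1 ^+ 2 * X^-1 ^+ r)) * (2 * theta) ^+ r =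
  (32 * expR 1 * ln b^-1 * b^-1 ^+ 2) *
  (m%:R * (expR 1 * (Delta ^ 2)%:R * X^-1 * (2 * theta)) ^+ r).
  by rewrite !exprMn; ring.
rewrite /c -[leRHS]mulrA; apply: ler_wpM2l => //.
have -> : 2 / 3 = 4 / 3 * (1 / 2) :> R by field.
have -> : 3 * (Delta%:R + 2) * (4 / 3 * (1 / 2)) ^+ r =
          ((Delta%:R + 2) * (3 * (4 / 3) ^+ r)) * (1 / 2) ^+ r :> R.
  by rewrite exprMn; ring.
have half0 : 0 <= expR 1 * (Delta ^ 2)%:R * X^-1 * (2 * theta).
  by rewrite mulr_ge0 ?mulr_ge0 ?(ltW e0) ?invr_ge0 ?(ltW X0) ?(ltW th0).
apply: ler_pM.
- by [].
- exact: exprn_ge0.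
- apply: (@le_trans _ _ ((Delta%:R + 2) * (1 + r%:R))); first by rewrite mE; nra.
  by apply: ler_wpM2l; [lra|exact: succ_le_pow].
- by apply: lerXn2r; rewrite ?nnegrE //; lra.
Qed.

End Numerics.

(** * From uniform to general block factorization *)

Section BlockFactorization.
Variables (R : realType) (q : nat) (V dV : finType) (S : spinSystem R q V dV).
Hypothesis Omega_neq0 : Omega S != set0.
Local Notation config := (config q V).
Local Notation p := (gibbs S).
Local Notation mu := (cond_expect S).
Implicit Types (s t u : config) (f : config -> R).

(** The function [f] set to 0 outside the support of the Gibbs measure. *)
Definition on_Omega f : config -> R := fun s => if s \in Omega S then f s else 0.

Lemma mean_Ent_on_Omega B f : mean_Ent S B (on_Omega f) = mean_Ent S B f.
Proof.
have eqO s : 0 < p s -> on_Omega f s = f s by rewrite gibbs_gt0 // /on_Omega => ->.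
apply: (expect_eq Omega_neq0) => s ps; rewrite eqO //.
by rewrite (cond_expect_eq Omega_neq0 (g := f)) // => t _ /eqO.
Qed.

Lemma Ent_on_Omega f : Ent S (on_Omega f) = Ent S f.
Proof. by rewrite !Ent_mean // mean_Ent_on_Omega. Qed.

(** Two spins possible at the same vertex would have total probability above 1,
    so that the Gibbs measure is concentrated on a single configuration. *)
Lemma Ent_eq0_large_b b f : marginally_bounded S b -> 1 / 2 < b -> Ent S f = 0.
Proof.
move=> [b0 margS] b2.
have uniq s t : 0 < p s -> 0 < p t -> t = s.
  move=> ps pt; apply/ffunP => x; apply/eqP/negPn/negP => neq.
  have off u : same_off setT s u by apply/same_offP => y; rewrite inE.
  have pin : pinning S (~: setT) s by apply: pinning_self.
  have bnd u : 0 < p u -> b <= \sum_(v : config | v x == u x) cond_gibbs S (~: setT) s v.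
    move=> pu; apply: (margS (~: setT)) => //.
    by apply/imsetP; exists u; rewrite // mem_cond_support // off.
  have tot : \sum_v cond_gibbs S (~: setT) s v = 1.
    under eq_bigr do rewrite cond_gibbsE off.
    rewrite -mulr_suml gibbs_sum1 // mul1r -[RHS]invr1; congr _^-1.
    by rewrite -(gibbs_sum1 Omega_neq0); apply: eq_bigl => u; rewrite off.
  have := tot; rewrite (bigID (fun v : config => v x == s x)) /= => tot'.
  have : b <= \sum_(v : config | v x != s x) cond_gibbs S (~: setT) s v.
    apply: (le_trans (bnd t pt)); rewrite [leLHS]big_mkcond [leRHS]big_mkcond /=.
    apply: ler_sum => v _; case: eqP => [->|_]; first by rewrite neq.
    case: ifP => // _; rewrite cond_gibbsE off.
    by rewrite divr_ge0 ?gibbs_ge0 ?class_mass_ge0.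
  have := bnd s ps; lra.
rewrite Ent_mean // /mean_Ent.
have -> : 0 = expect S (fun=> 0) by rewrite /expect big1 // => s _; rewrite mulr0.
apply: (expect_eq Omega_neq0) => s ps.
have -> : mu setT f s = f s.
  rewrite -[RHS](cond_expect_cst Omega_neq0 setT _ ps).
  by apply: (cond_expect_eq Omega_neq0) => t _ pt; rewrite (uniq s t).
have [->|fn] := eqVneq (f s) 0; first by rewrite mul0r.
by rewrite divff // ln1 mulr0.
Qed.

Lemma GBF_Ent_eq0 f (alpha : {set V} -> R) (C d : R) : (forall t, 0 <= f t) ->
  Ent S f = 0 -> d * Ent S f <= C * \sum_B alpha B * mean_Ent S B f.
Proof.
move=> f0 Ent0; have el := mean_Ent_entropy_like Omega_neq0 f0.
rewrite Ent0 mulr0 big1 ?mulr0 // => B _.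
suff -> : mean_Ent S B f = 0 by rewrite mulr0.
apply/eqP; rewrite eq_le mean_Ent_ge0 // andbT -Ent0 Ent_mean //.
exact: (el_mono el (subsetT B)).
Qed.

Lemma delta_ge0 (alpha : {set V} -> R) : (forall B, 0 <= alpha B) -> 0 <= delta alpha.
Proof.
move=> a0; apply: le_bigmin => // x _; apply: sumr_ge0 => B _; exact: a0.
Qed.

Lemma delta_le (alpha : {set V} -> R) x :
  delta alpha <= \sum_(B : {set V} | x \in B) alpha B.
Proof. exact: bigmin_le. Qed.

Section Average.
Variables (b theta : R) (Delta : nat).
Hypothesis connS : totally_connected S.
Hypothesis margS : marginally_bounded S b.
Hypothesis degS : max_degree S = Delta.
Hypothesis Delta_gt0 : (0 < Delta)%N.
Hypothesis theta_gt0 : 0 < theta.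
Hypothesis theta_le :
  theta <= b ^+ (2 * (Delta + 1)) / (4 * expR 1 * Delta%:R ^+ 2).
Hypothesis b_le : b <= 1 / 2.
Variable (c : V -> 'I_Delta.+1).
Hypothesis c_proper : forall x y, vertex_adj S x y -> c x != c y.

Let l := `|Num.ceil (theta * #|V|%:R)|%N.
Let b_gt0 : 0 < b. Proof. by case: margS. Qed.

(** A positive maximum degree forces an interior vertex, boundary vertices being
    pairwise non-adjacent. *)
Lemma vertices_gt0 : (0 < #|V|)%N.
Proof.
rewrite lt0n; apply/negP => /eqP/card0_eq V0; move: Delta_gt0.
rewrite -degS /max_degree.
suff -> : (\max_x #|[set y | adj S x y]| = 0)%N by [].
apply/eqP; rewrite -leqn0; apply/bigmax_leqP => -[x|x] _; first by have := V0 x; rewrite inE.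
rewrite leqn0 cards_eq0 -subset0; apply/subsetP => -[y|y]; first by have := V0 y; rewrite inE.
by rewrite inE (negPf (adj_bdry S x y)).
Qed.

Lemma theta_bound : theta * (4 * expR 1 * Delta%:R ^+ 2) <= b ^+ (2 * (Delta + 1)).
Proof.
by rewrite -ler_pdivlMr // !mulr_gt0 ?expR_gt0 ?exprn_gt0 ?ltr0n.
Qed.

Lemma theta_le1 : theta <= 1.
Proof.
have := theta_bound; set X := b ^+ _ => hX.
have X1 : X <= 1 by rewrite exprn_ile1 ?(ltW b_gt0) //; move: b_le; lra.
have e1 : 1 <= expR 1 :> R by rewrite (le_trans _ (expR_ge1Dx 1)) // lerDl.
have D1 : 1 <= Delta%:R ^+ 2 :> R by rewrite exprn_ege1 // ler1n.
have eD : 1 <= expR 1 * Delta%:R ^+ 2 :> R by apply: mulr_ege1.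
move: theta_gt0 => th0; nra.
Qed.

Lemma block_size_itv :
  theta * #|V|%:R <= l%:R /\ l%:R < theta * #|V|%:R + 1.
Proof.
have n0 : 0 < #|V|%:R :> R by rewrite ltr0n vertices_gt0.
have c0 : 0 <= Num.ceil (theta * #|V|%:R).
  by rewrite ceil_ge0 (lt_trans (ltrN10 R)) // mulr_gt0.
have lE : l%:R = (Num.ceil (theta * #|V|%:R))%:~R :> R.
  by rewrite -[in RHS](gez0_abs c0).
rewrite lE; have /andP[h1 h2] := ceil_itv (theta * #|V|%:R).
by split=> //; rewrite -ltrBlDr; move: h1; rewrite rmorphB.
Qed.

Lemma block_size_le : (l <= #|V|)%N.
Proof.
have [_ lt] := block_size_itv.
rewrite -ltnS -(ltr_nat R) -natr1; apply: (lt_le_trans lt); rewrite lerD2r.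
by rewrite ler_piMl // theta_le1.
Qed.

Lemma block_size_gt0 : (0 < l)%N.
Proof.
have [le _] := block_size_itv.
rewrite -(ltr_nat R); apply: (lt_le_trans _ le).
by rewrite mulr_gt0 // ltr0n vertices_gt0.
Qed.

(** The factor lost from uniform blocks to colour classes. *)
Definition average_const : R := 864 * expR 1 * Delta%:R * ln b^-1 * b^-1 ^+ 2.

Lemma average_const_ge1 : 1 <= average_const.
Proof.
have lam := ln_inv_ge b_gt0 b_le.
have e1 : 1 <= expR 1 :> R by rewrite (le_trans _ (expR_ge1Dx 1)) // lerDl.
have D1 : 1 <= Delta%:R :> R by rewrite ler1n.
have B1 : 1 <= b^-1 ^+ 2.
  by rewrite exprn_ege1 // invf_ge1 //; move: b_le; lra.
have h1 : 1 <= expR 1 * Delta%:R * b^-1 ^+ 2 :> R by do 2?[apply: mulr_ege1 => //].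
have -> : average_const = (864 * ln b^-1) * (expR 1 * Delta%:R * b^-1 ^+ 2).
  by rewrite /average_const; ring.
by apply: mulr_ege1 => //; lra.
Qed.

(** From uniform blocks to colour classes. Blocks of size [l >= 2] have density
    at most [2 * theta]; a single vertex lies in a colour class. *)
Lemma average_block_entropy f : (forall t, 0 <= f t) ->
  'C(#|V|, l)%:R^-1 * \sum_(B : {set V} | #|B| == l) mean_Ent S B f <=
  average_const * \sum_j mean_Ent S (colour_class c j) f.
Proof.
move=> f0; have el := mean_Ent_entropy_like Omega_neq0 f0.
have n0 := vertices_gt0.
have sum0 : 0 <= \sum_j mean_Ent S (colour_class c j) f.
  by apply: sumr_ge0 => j _; apply: mean_Ent_ge0.
have [l1|l2] := leqP l 1.
  have l1' : l = 1%N by apply/eqP; rewrite eqn_leq l1 block_size_gt0.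
  apply: (@le_trans _ _ (\sum_j mean_Ent S (colour_class c j) f)); last first.
    by rewrite ler_peMl // average_const_ge1.
  rewrite l1' ler_pdivrMl ?ltr0n ?bin_gt0 //.
  rewrite -card_draws -[X in _ <= X%:R * _]cardsE -sum1_card natr_sum mulr_suml.
  rewrite [leRHS](eq_bigl (fun B : {set V} => #|B| == 1%N)); last first.
    by move=> B; rewrite !inE.
  apply: ler_sum => B /cards1P[x ->]; rewrite mul1r.
  rewrite (bigD1 (c x)) //= -[leLHS]addr0; apply: lerD.
    by apply: (el_mono el); rewrite sub1set inE.
  by apply: sumr_ge0 => j _; apply: mean_Ent_ge0.
have b1 : b <= 1 by move: b_le; lra.
have esym := vertex_adj_sym S.
have edeg x : (#|[set y | vertex_adj S x y]| <= Delta)%N by rewrite -degS degree_bound.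
have loc (C Q : {set V}) : separated (vertex_adj S) C Q ->
  mean_Ent S (Q :|: C) f - mean_Ent S Q f <=
  local_const b #|C| * \sum_j (mean_Ent S ((Q :|: C) :&: colour_class c j) f
                               - mean_Ent S (Q :&: colour_class c j) f).
  exact: local_increment.
apply: (le_trans (uniform_block_bound esym edeg Delta_gt0 el c_proper
   (fun m => local_const_ge0 b_gt0 b1 m) (local_const_mono b_gt0 b1) loc n0
   block_size_le)).
apply: ler_wpM2r => //.
apply: (cluster_series_bound b_gt0 b_le Delta_gt0 n0 theta_gt0 theta_bound).
have [_ lt] := block_size_itv.
have nR : 0 < #|V|%:R :> R by rewrite ltr0n.
rewrite ler_pdivrMr //; have : 2 <= l%:R :> R by rewrite ler_nat.
lra.
Qed.

(** From colour classes to arbitrary blocks: the Shearer inequality holds on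
    each of the [Delta + 1] classes. *)
Lemma GBF_of_UBF (C_UBF : R) : 0 <= C_UBF -> UBF S l C_UBF ->
  forall f (alpha : {set V} -> R), (forall t, 0 <= f t) -> (forall B, 0 <= alpha B) ->
  delta alpha * Ent S f <=
  C_UBF * (1728 * expR 1 * ((theta * b ^+ 2)^-1 * ln b^-1 * Delta%:R ^+ 3)) *
    \sum_B alpha B * mean_Ent S B f.
Proof.
move=> C0 ubf f alpha f0 a0.
have el := mean_Ent_entropy_like Omega_neq0 f0.
have n0 := vertices_gt0.
have nR : 0 < #|V|%:R :> R by rewrite ltr0n.
have d0 := delta_ge0 a0.
have Ent0 : 0 <= Ent S f by rewrite Ent_mean // mean_Ent_ge0.
have K0 : 0 <= average_const by apply: le_trans average_const_ge1.
set M := \sum_B alpha B * mean_Ent S B f.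
have M0 : 0 <= M by apply: sumr_ge0 => B _; rewrite mulr_ge0 ?a0 ?mean_Ent_ge0.
have h1 : theta * Ent S f <= C_UBF * (average_const * \sum_j mean_Ent S (colour_class c j) f).
  apply: (@le_trans _ _ (l%:R / #|V|%:R * Ent S f)).
    by apply: ler_wpM2r => //; rewrite ler_pdivlMr //; have [] := block_size_itv.
  apply: (le_trans (ubf f _)); first by move=> s _; apply: f0.
  by apply: ler_wpM2l => //; apply: average_block_entropy.
have h2 : delta alpha * \sum_j mean_Ent S (colour_class c j) f <= (Delta%:R + 1) * M.
  rewrite mulr_sumr.
  have -> : (Delta%:R + 1) * M = \sum_(j < Delta.+1) M.
    by rewrite sumr_const card_ord natr1 mulr_natl.
  apply: ler_sum => j _.
  apply: (le_trans (independent_shearer el (colour_class_indep c_proper (j := j)) a0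
     (delta_le alpha))).
  apply: ler_sum => B _; apply: ler_wpM2l => //.
  by apply: (el_mono el); apply: subsetIl.
have h3 : theta * (delta alpha * Ent S f) <= C_UBF * average_const * ((Delta%:R + 1) * M).
  rewrite mulrCA; apply: (le_trans (ler_wpM2l d0 h1)).
  have -> : delta alpha * (C_UBF * (average_const * \sum_j mean_Ent S (colour_class c j) f))
    = C_UBF * average_const * (delta alpha * \sum_j mean_Ent S (colour_class c j) f) by ring.
  by apply: ler_wpM2l => //; apply: mulr_ge0.
rewrite -(ler_pM2l theta_gt0); apply: (le_trans h3).
have D1 : 1 <= Delta%:R :> R by rewrite ler1n.
have lam := ln_inv_ge b_gt0 b_le.
have w0 : 0 <= C_UBF * (864 * expR 1 * ln b^-1 * b^-1 ^+ 2) * M.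
  by rewrite !mulr_ge0 ?expR_ge0 ?exprn_ge0 ?invr_ge0 ?(ltW b_gt0) //; lra.
have -> : C_UBF * average_const * ((Delta%:R + 1) * M) =
   C_UBF * (864 * expR 1 * ln b^-1 * b^-1 ^+ 2) * M * (Delta%:R * (Delta%:R + 1)).
  by rewrite /average_const; ring.
have -> : theta * (C_UBF * (1728 * expR 1 * ((theta * b ^+ 2)^-1 * ln b^-1 * Delta%:R ^+ 3)) * M)
   = C_UBF * (864 * expR 1 * ln b^-1 * b^-1 ^+ 2) * M * (2 * Delta%:R ^+ 3).
  by field; rewrite !gt_eqF.
apply: ler_wpM2l => //.
have D2 : Delta%:R <= Delta%:R ^+ 2 :> R by rewrite expr2 ler_peMl //; lra.
have D3 : Delta%:R ^+ 2 <= Delta%:R ^+ 3 :> R by rewrite (exprS _ 2) ler_peMl //; lra.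
have -> : Delta%:R * (Delta%:R + 1) = Delta%:R ^+ 2 + Delta%:R :> R by ring.
lra.
Qed.

End Average.
End BlockFactorization.

Theorem theorem3p2 (R : realType) :
  exists2 K : R, 0 < K &
  forall (q : nat) (V dV : finType) (S : spinSystem R q V dV)
         (b theta C_UBF : R) (Delta : nat),
  (2 <= q)%N ->
  Omega S != set0 ->
  totally_connected S ->
  marginally_bounded S b ->
  max_degree S = Delta ->
  (1 <= Delta)%N ->
  0 < theta ->
  theta <= b ^+ (2 * (Delta + 1)) / (4 * expR 1 * Delta%:R ^+ 2) ->
  UBF S `|Num.ceil (theta * #|V|%:R)|%N C_UBF ->
  GBF S (C_UBF * (K * ((theta * b ^+ 2)^-1 * ln (b^-1) * Delta%:R ^+ 3))).
Proof.
exists (1728 * expR 1); first by rewrite mulr_gt0 ?expR_gt0.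
move=> q V dV S b theta C_UBF Delta _ O0 connS margS degS D0 th0 thle ubf f f0 alpha a0 _.
have g0 t : 0 <= on_Omega S f t by rewrite /on_Omega; case: ifP => // /f0.
rewrite -(Ent_on_Omega O0); under eq_bigr do rewrite -(mean_Ent_on_Omega O0).
move: (on_Omega S f) g0 => g g0 {f f0}.
have [b2|b2] := leP b (1 / 2); last first.
  by apply: (GBF_Ent_eq0 O0) => //; apply: (Ent_eq0_large_b O0 _ margS b2).
have esym := vertex_adj_sym S.
have eirr : irreflexive (vertex_adj S) by move=> x; apply: adj_irr.
have edeg x : (#|[set y | vertex_adj S x y]| <= Delta)%N by rewrite -degS degree_bound.
have [c c_proper] := greedy_colouring esym eirr edeg.
have [C0|C0] := leP 0 C_UBF.
  exact: (GBF_of_UBF O0 connS margS degS D0 th0 thle b2 c_proper C0 ubf).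
(* a negative constant in the hypothesis forces all entropies to vanish *)
apply: (GBF_Ent_eq0 O0) => //; apply/eqP; rewrite eq_le.
have -> : 0 <= Ent S g by rewrite Ent_mean // mean_Ent_ge0.
rewrite andbT.
set l := `|_|%N in ubf.
have l0 : (0 < l)%N := block_size_gt0 degS D0 th0.
have n0 := vertices_gt0 degS D0.
have w0 : 0 < l%:R / #|V|%:R :> R by rewrite divr_gt0 ?ltr0n.
rewrite -(pmulr_rle0 _ w0); apply: (le_trans (ubf g _)); first by move=> s _.
rewrite nmulr_rle0 // mulr_ge0 ?invr_ge0 //.
by apply: sumr_ge0 => B _; apply: mean_Ent_ge0.
Qed.
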